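(* Let $k_1,k_2,k_3,k_4>0$ and consider on $(0,L)\times(0,\infty)$ the closed-loop fully dynamic Rao-Nakra system $$\begin{cases}\rho_1h_1\ddot v^1-\alpha^1 h_1 v^1_{xx}-G_2\phi^2=0,\\ \rho_3h_3\ddot v^3-\alpha^3h_3v^3_{xx}+\gamma\beta h_3p_{xx}+G_2\phi^2=0,\\ \mu h_3\ddot p-\beta h_3p_{xx}+\gamma\beta h_3v^3_{xx}=0,\\ m\ddot w-K_1\ddot w_{xx}+K_2w_{xxxx}-G_2H\phi^2_x=0,\\ \phi^2=\frac1{h_2}(-v^1+v^3+Hw_x),\end{cases}$$ with boundary conditions $v^1=v^3=p=w=w_x=0$ at $x=0$ and, at $x=L$, $$\alpha^1h_1v^1_x=-k_1\dot v^1,\quad \alpha^3h_3v^3_x-\gamma\beta h_3p_x=0,\quad \beta h_3p_x-\gamma\beta h_3v^3_x=-k_2\dot p,$$ $$K_2w_{xx}=-k_3\dot w_x,\quad K_1\ddot w_x-K_2w_{xxx}+G_2H\phi^2=-k_4\dot w .$$ Then the inertial sliding solutions are strongly stable: every solution $\varphi(t)=(v^1,v^3,p,w,\dot v^1,\dot v^3,\dot p,\dot w)(\cdot,t)$ with initial data in $\mathcal H$ and with $w\equiv 0$ satisfies $\|\varphi(t)\|_{\mathcal H}\to0$ as $t\to\infty$.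
   Context: Superscripts on $v,\alpha,\phi$ are indices, not powers; dots are time derivatives and subscripts $x$ are space derivatives. All constants $\rho_i,h_i$ $(i=1,2,3)$, $L,\alpha^1,\alpha_1^3,\gamma,\beta,\mu,G_2$ are positive; $\alpha^3=\alpha_1^3+\gamma^2\beta$, $H=\frac{h_1+2h_2+h_3}{2}$, $m=\rho_1h_1+\rho_2h_2+\rho_3h_3$, $K_1=\frac{\rho_1h_1^3+\rho_3h_3^3}{12}$, $K_2=\frac{\alpha^1h_1^3+\alpha^3h_3^3}{12}$. $H^1_L(0,L)=\{\psi\in H^1(0,L):\psi(0)=0\}$, $H^2_L(0,L)=\{\psi\in H^2(0,L):\psi(0)=\psi_x(0)=0\}$. The (complex) energy space is $\mathcal H=(H^1_L(0,L))^3\times H^2_L(0,L)\times (L^2(0,L))^3\times H^1_L(0,L)$ with the norm $\|\varphi\|_{\mathcal H}^2=2\mathrm E$, where for $\varphi=(v^1,v^3,p,w,\dot v^1,\dot v^3,\dot p,\dot w)$ $$2\mathrm E=\int_0^L\Big\{\rho_1h_1|\dot v^1|^2+\rho_3h_3|\dot v^3|^2+\mu h_3|\dot p|^2+m|\dot w|^2+K_1|\dot w_x|^2+\alpha^1h_1|v^1_x|^2+\alpha^3h_3|v^3_x|^2+K_2|w_{xx}|^2-\gamma\beta h_3(v^3_x\bar p_x+p_x\bar v^3_x)+\beta h_3|p_x|^2+G_2h_2|\phi^2|^2\Big\}dx .$$ Solutions are understood in the (mild) semigroup sense in $\mathcal H$. Inertial sliding solutions are those with no bending, i.e. $w\equiv0$.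 *)

(* Defs.v *)
From mathcomp Require Import all_boot all_order all_algebra.
From mathcomp Require Import all_classical all_reals all_analysis.
From mathcomp.real_closed Require Import complex.

Set Implicit Arguments.
Unset Strict Implicit.
Unset Printing Implicit Defensive.

Import Order.TTheory GRing.Theory Num.Theory.
Import numFieldNormedType.Exports.
Import ComplexField.Normc.

Local Open Scope classical_set_scope.
Local Open Scope ring_scope.
Local Open Scope complex_scope.

(* [alpha1], [alpha31] are $\alpha^1$, $\alpha^3_1$; the superscripts are
   indices. *)
Record coeffs (R : realType) := Coeffs {
  rho1 : R; rho2 : R; rho3 : R;
  h1 : R; h2 : R; h3 : R;
  len : R;
  alpha1 : R; alpha31 : R;
  gamma : R; beta : R; mu : R; G2 : R;
  rho1_gt0 : 0 < rho1; rho2_gt0 : 0 < rho2; rho3_gt0 : 0 < rho3;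
  h1_gt0 : 0 < h1; h2_gt0 : 0 < h2; h3_gt0 : 0 < h3;
  len_gt0 : 0 < len;
  alpha1_gt0 : 0 < alpha1; alpha31_gt0 : 0 < alpha31;
  gamma_gt0 : 0 < gamma; beta_gt0 : 0 < beta; mu_gt0 : 0 < mu;
  G2_gt0 : 0 < G2 }.

Definition alpha3 (R : realType) (c : coeffs R) : R :=
  alpha31 c + gamma c ^+ 2 * beta c.
Definition HH (R : realType) (c : coeffs R) : R :=
  (h1 c + 2 * h2 c + h3 c) / 2.
Definition mass (R : realType) (c : coeffs R) : R :=
  rho1 c * h1 c + rho2 c * h2 c + rho3 c * h3 c.
Definition K1 (R : realType) (c : coeffs R) : R :=
  (rho1 c * h1 c ^+ 3 + rho3 c * h3 c ^+ 3) / 12.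
Definition K2 (R : realType) (c : coeffs R) : R :=
  (alpha1 c * h1 c ^+ 3 + alpha3 c * h3 c ^+ 3) / 12.

(* Members of the function spaces on (0, l) are represented by functions on
   the whole line, of which only the values on [0, l] matter. *)
Notation cfun R := (Real.sort R -> complex (Real.sort R)).

Definition cintegral (R : realType) (a b : R) (f : cfun R) : R[i] :=
  (\int[@lebesgue_measure R]_(x in `]a, b[) complex.Re (f x))
  +i* (\int[@lebesgue_measure R]_(x in `]a, b[) complex.Im (f x)).

Definition L2 (R : realType) (l : R) (f : cfun R) : Prop :=
  [/\ measurable_fun `]0, l[ (fun x => complex.Re (f x)),
      measurable_fun `]0, l[ (fun x => complex.Im (f x)) &
      (\int[@lebesgue_measure R]_(x in `]0%R, l[) ((normc (f x)) ^+ 2)%:E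
         < +oo)%E].

Definition ae_on (R : realType) (l : R) (P : R -> Prop) : Prop :=
  \forall x \ae @lebesgue_measure R, x \in `]0, l[ -> P x.

(* [f] is the absolutely continuous representative of an element of
   H^1(0, l) and [g] is a representative of its weak derivative. In a chain
   [wderiv l f g], [wderiv l g k] the function [g] is itself absolutely
   continuous on [0, l], so that its boundary values are traces. *)
Definition wderiv (R : realType) (l : R) (f g : cfun R) : Prop :=
  L2 l g /\ forall x, x \in `[0, l] -> f x = f 0 + cintegral 0 x g.

Definition H1 (R : realType) (l : R) (f : cfun R) : Prop :=
  exists fx, wderiv l f fx.

Definition H1L (R : realType) (l : R) (f : cfun R) : Prop :=
  H1 l f /\ f 0 = 0.

Definition H2L (R : realType) (l : R) (f : cfun R) : Prop :=
  exists fx fxx, [/\ wderiv l f fx, wderiv l fx fxx, f 0 = 0 & fx 0 = 0].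

(* Representatives of the (a.e. unique) first and second weak derivatives. *)
Definition dx (R : realType) (l : R) (f : cfun R) : cfun R :=
  xget (0 : cfun R) [set g | wderiv l f g].

Definition dxx (R : realType) (l : R) (f : cfun R) : cfun R :=
  xget (0 : cfun R) [set k | exists2 g, wderiv l f g & wderiv l g k].

(* (((v1, v3), (p, w)), the corresponding velocities), with the componentwise
   vector space structure. *)
Notation state R :=
  (((cfun R * cfun R) * (cfun R * cfun R)) *
   ((cfun R * cfun R) * (cfun R * cfun R)))%type.

Definition v1 (R : realType) (u : state R) : cfun R := u.1.1.1.
Definition v3 (R : realType) (u : state R) : cfun R := u.1.1.2.
Definition p (R : realType) (u : state R) : cfun R := u.1.2.1.
Definition w (R : realType) (u : state R) : cfun R := u.1.2.2.
Definition v1_t (R : realType) (u : state R) : cfun R := u.2.1.1.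
Definition v3_t (R : realType) (u : state R) : cfun R := u.2.1.2.
Definition p_t (R : realType) (u : state R) : cfun R := u.2.2.1.
Definition w_t (R : realType) (u : state R) : cfun R := u.2.2.2.

Definition phi2 (R : realType) (c : coeffs R) (v1 v3 wx : cfun R) : cfun R :=
  fun x => ((h2 c)^-1)%:C * (- v1 x + v3 x + (HH c)%:C * wx x).

Definition in_energy_space (R : realType) (c : coeffs R) (u : state R) :
    Prop :=
  let l := len c in
  [/\ H1L l (v1 u), H1L l (v3 u), H1L l (p u) & H2L l (w u)] /\
  [/\ L2 l (v1_t u), L2 l (v3_t u), L2 l (p_t u) & H1L l (w_t u)].

Definition energy2 (R : realType) (c : coeffs R) (u : state R) : R :=
  let d := dx (len c) in
  \int[@lebesgue_measure R]_(x in `]0, len c[)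
    (rho1 c * h1 c * normc (v1_t u x) ^+ 2
     + rho3 c * h3 c * normc (v3_t u x) ^+ 2
     + mu c * h3 c * normc (p_t u x) ^+ 2
     + mass c * normc (w_t u x) ^+ 2
     + K1 c * normc (d (w_t u) x) ^+ 2
     + alpha1 c * h1 c * normc (d (v1 u) x) ^+ 2
     + alpha3 c * h3 c * normc (d (v3 u) x) ^+ 2
     + K2 c * normc (dxx (len c) (w u) x) ^+ 2
     - gamma c * beta c * h3 c *
         complex.Re (d (v3 u) x * (d (p u) x)^* + d (p u) x * (d (v3 u) x)^*)
     + beta c * h3 c * normc (d (p u) x) ^+ 2
     + G2 c * h2 c * normc (phi2 c (v1 u) (v3 u) (d (w u)) x) ^+ 2).

Definition energy_norm (R : realType) (c : coeffs R) (u : state R) : R :=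
  Num.sqrt (energy2 c u).

(* Graph of the generator A of the closed-loop system: [u] lies in Dom(A) and
   [A u = f]. The displacement components of [f] are the H^1 representatives
   of the velocities in [u], so the boundary values of v1_t and p_t are those
   of [v1 f] and [p f]; the velocity components of [f] are the accelerations.
   For u in Dom(A) the acceleration w_tt is only in H^1, so the bending
   equation is written in divergence form, m w_tt = q_x for the shear force
   q = K1 w_ttx - K2 w_xxx + G2 H phi2; it is q, and not its separate
   summands, that has a trace at x = L. *)
Definition generator (R : realType) (c : coeffs R) (k1 k2 k3 k4 : R)
    (u f : state R) : Prop :=
  let l := len c in
  [/\ in_energy_space c u, in_energy_space c f,
      [/\ ae_on l (fun x => v1 f x = v1_t u x),
          ae_on l (fun x => v3 f x = v3_t u x),
          ae_on l (fun x => p f x = p_t u x) &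
          forall x, x \in `[0, l] -> w f x = w_t u x] &
   exists v1x v1xx v3x v3xx px pxx : cfun R,
   exists wx wxx wxxx wtx wtxx wttx q : cfun R,
   let ph := phi2 c (v1 u) (v3 u) wx in
   [/\ [/\ wderiv l (v1 u) v1x /\ wderiv l v1x v1xx,
           wderiv l (v3 u) v3x /\ wderiv l v3x v3xx,
           wderiv l (p u) px /\ wderiv l px pxx,
           [/\ wderiv l (w u) wx, wderiv l wx wxx & wderiv l wxx wxxx] &
           [/\ wderiv l (w f) wtx, wderiv l wtx wtxx & wderiv l (w_t f) wttx]],
       [/\ ae_on l (fun x =>
             (rho1 c * h1 c)%:C * v1_t f x - (alpha1 c * h1 c)%:C * v1xx x
             - (G2 c)%:C * ph x = 0),
           ae_on l (fun x =>
             (rho3 c * h3 c)%:C * v3_t f x - (alpha3 c * h3 c)%:C * v3xx x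
             + (gamma c * beta c * h3 c)%:C * pxx x + (G2 c)%:C * ph x = 0),
           ae_on l (fun x =>
             (mu c * h3 c)%:C * p_t f x - (beta c * h3 c)%:C * pxx x
             + (gamma c * beta c * h3 c)%:C * v3xx x = 0),
           ae_on l (fun x =>
             q x = (K1 c)%:C * wttx x - (K2 c)%:C * wxxx x
                   + (G2 c * HH c)%:C * ph x) &
           wderiv l q (fun x => (mass c)%:C * w_t f x)] &
       [/\ (alpha1 c * h1 c)%:C * v1x l = - (k1%:C * v1 f l),
           (alpha3 c * h3 c)%:C * v3x l
             - (gamma c * beta c * h3 c)%:C * px l = 0,
           (beta c * h3 c)%:C * px l - (gamma c * beta c * h3 c)%:C * v3x l
             = - (k2%:C * p f l),
           (K2 c)%:C * wxx l = - (k3%:C * wtx l) &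
           q l = - (k4%:C * w f l)]]].

(* Limits in time are taken along [0, +oo[, hence one-sided at t = 0. *)
Definition energy_continuous (R : realType) (c : coeffs R)
    (u : R -> state R) : Prop :=
  forall t, 0 <= t ->
    energy_norm c (u s - u t) @[s --> within `[0, +oo[ (nbhs t)] --> (0 : R).

Definition energy_derivative (R : realType) (c : coeffs R)
    (U u : R -> state R) : Prop :=
  forall t, 0 <= t ->
    energy_norm c (((s - t)^-1)%:C *: (U s - U t) - u t)
      @[s --> within `[0, +oo[ t^'] --> (0 : R).

(* Mild solution of u' = A u: u is continuous into the energy space and, for
   every t >= 0, the integral U t of u over [0, t] lies in Dom(A) and
   A (U t) = u t - u 0. As u is continuous, its integral is the function U
   with U 0 = 0 and derivative u in the energy norm. *)
Definition mild_solution (R : realType) (c : coeffs R) (k1 k2 k3 k4 : R)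
    (u : R -> state R) : Prop :=
  [/\ forall t, 0 <= t -> in_energy_space c (u t),
      energy_continuous c u &
      exists U : R -> state R,
        [/\ U 0 = 0,
            energy_derivative c U u &
            forall t, 0 <= t -> generator c k1 k2 k3 k4 (U t) (u t - u 0)]].

Definition inertial_sliding (R : realType) (c : coeffs R)
    (u : R -> state R) : Prop :=
  forall t x, 0 <= t -> x \in `[0, len c] -> w (u t) x = 0.

(* Main.v *)
Require Import Defs.
From mathcomp Require Import all_boot all_order all_algebra.
From mathcomp Require Import all_classical all_reals all_analysis.
From mathcomp Require Import measurable_realfun ring lra.
From mathcomp.real_closed Require Import complex.
Import Order.TTheory GRing.Theory Num.Theory.
Import numFieldNormedType.Exports.
Import ComplexField.Normc.
Local Open Scope classical_set_scope.
Local Open Scope ring_scope.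

(** A mild solution with w = 0 vanishes identically, so its energy norm is 0.

    Formally, w = 0 reduces the bending equation and the shear condition at
    x = L to phi2_x = 0 and phi2(L) = 0, hence v1 = v3 =: v. The equations of
    the two outer layers then express p_xx as a multiple kap v_xx, so
    p = kap v + c(t) x, where c is proportional to v_x(t, L) by the stress-free
    condition. The third equation becomes dl v_tt = - c''(t) x for a constant
    dl, and two cases remain.

    - If dl <> 0, then v = a(t) x + b(t) x^3, the wave equation makes a and b
      polynomials in t, and the condition alpha1 h1 v_x = - k1 v_t at x = L
      forces them to vanish ([cubic_wave_at_rest]).
    - If dl = 0, then c'' = 0, so v_x(t, L), and with it v_t(t, L), is affine in
      t. D'Alembert's formula in the space direction continues these data to
      x = 0, where v = 0 forces them to be 0; then v = 0
      ([linear_trace_wave_at_rest]).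

    In both cases v = 0, then c = 0 and p = 0 ([sandwich_at_rest]). Damping
    enters only through the boundary condition at x = L; the solution vanishes
    from the start rather than decaying.

    A mild solution u is not differentiable in time, so the argument is run on
    U(t), the integral of u over [0, t], which is in the domain of the generator
    A, with A U = u - u(0) and U' = u in the energy norm. The energy norm bounds
    the displacements and the primitives of the velocities pointwise
    ([controlled_displacements], [controlled_w], [controlled_velocities]), hence
    these have time derivatives that are uniform in x
    ([controlled_uniform_derive]), and the equations, integrated in space and
    in time, become identities between continuous functions. The real and
    imaginary parts are treated separately. Conversely, a state whose
    displacements and primitives of velocities vanish has energy 0 by Lebesgue's
    differentiation theorem ([energy_at_rest]). *)

Set Implicit Arguments.
Unset Strict Implicit.
Unset Printing Implicit Defensive.

(** * Derivatives relative to a set, and transport along characteristics *)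

Section RelativeDerivatives.
Variable R : realType.
Implicit Types (A B : set R) (f g : R -> R) (a b x t d e : R).

(** Relative to [A], so that the time axis [0, +oo[ and the closed interval
    [0, L] include their endpoints, where the derivative is one-sided. *)
Definition has_derive A f x d :=
  forall e, 0 < e ->
    \forall y \near x, A y -> `|f y - f x - d * (y - x)| <= e * `|y - x|.

Definition cont_in A f x :=
  forall e, 0 < e -> \forall y \near x, A y -> `|f y - f x| <= e.

Lemma near_dist x (e : R) : 0 < e -> \forall y \near x, `|y - x| < e.
Proof.
by move=> e0; apply/nbhs_ballP; exists e => //= y; rewrite /ball /= distrC.
Qed.

Lemma has_derive_cst A (k : R) x : has_derive A (fun=> k) x 0.
Proof.
by move=> e e0; near=> y => _; rewrite subrr mul0r subr0 normr0 mulr_ge0// ltW.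
Unshelve. all: by end_near. Qed.

Lemma has_deriveD A f g x d d' : has_derive A f x d -> has_derive A g x d' ->
  has_derive A (fun y => f y + g y) x (d + d').
Proof.
move=> fd gd e e0; have e2 : 0 < e / 2 by rewrite divr_gt0.
near=> y => Ay.
have /(_ Ay) h1 : A y -> `|f y - f x - d * (y - x)| <= e / 2 * `|y - x|.
  by near: y; exact: (fd _ e2).
have /(_ Ay) h2 : A y -> `|g y - g x - d' * (y - x)| <= e / 2 * `|y - x|.
  by near: y; exact: (gd _ e2).
rewrite [X in `|X|](_ : _ = (f y - f x - d * (y - x)) +
  (g y - g x - d' * (y - x))); last by ring.
rewrite (le_trans (ler_normD _ _))// (splitr e) mulrDl lerD//.
Unshelve. all: by end_near. Qed.

Lemma has_deriveZ A f (k : R) x d : has_derive A f x d ->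
  has_derive A (fun y => k * f y) x (k * d).
Proof.
move=> fd e e0; have k1 : 0 < 1 + `|k| by rewrite ltr_pwDl.
near=> y => Ay.
have /(_ Ay) h1 : A y -> `|f y - f x - d * (y - x)| <=
  e / (1 + `|k|) * `|y - x|.
  by near: y; exact: (fd _ (divr_gt0 e0 k1)).
rewrite -mulrBr -mulrA -mulrBr normrM.
rewrite (le_trans (ler_wpM2l _ h1))// mulrA ler_wpM2r//.
by rewrite mulrCA ler_piMr ?(ltW e0)// ler_pdivrMr// mul1r lerDr.
Unshelve. all: by end_near. Qed.

Lemma has_deriveB A f g x d d' : has_derive A f x d -> has_derive A g x d' ->
  has_derive A (fun y => f y - g y) x (d - d').
Proof.
move=> fd /(has_deriveZ (-1)) gd; have := has_deriveD fd gd.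
rewrite mulN1r; congr has_derive.
by apply/funext => y; rewrite mulN1r.
Qed.

Lemma eq_has_derive A f g x d : A x -> {in A, f =1 g} ->
  has_derive A f x d -> has_derive A g x d.
Proof.
move=> Ax fg fd e e0; apply: filterS (fd e e0) => y h Ay.
by rewrite -!fg ?inE//; apply: h.
Qed.

Lemma sub_has_derive A B f x d : B `<=` A ->
  has_derive A f x d -> has_derive B f x d.
Proof. by move=> BA fd e e0; apply: filterS (fd e e0) => y h /BA. Qed.

Lemma has_deriveTP f x d : has_derive setT f x d <-> is_derive x 1 f d.
Proof.
have E h : h != 0 -> `|h^-1 *: ((f \o shift x) (h *: 1) - f x) - d| =
    `|f (h + x) - f x - d * ((h + x) - x)| / `|h|.
  move=> h0; rewrite addrK/= -[h *: 1]/(h * 1) mulr1 -normfV -normrM.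
  by congr `|_|; rewrite -[_ *: _]/(_ * _); field.
split=> [fd|fd e e0].
- suff fdd : h^-1 *: ((f \o shift x) (h *: 1) - f x) @[h --> 0^'] --> d.
    by split; [apply/cvg_ex; exists d | apply/cvg_lim].
  apply/cvgrPdist_le => e e0; rewrite near_withinE.
  have := fd e e0; rewrite (near_shift 0) subr0 => H; near=> h => /= h0.
  rewrite distrC E// ler_pdivrMr ?normr_gt0// -[X in e * `|X|](addrK x h).
  by near: h; move: H; apply: filterS => h /(_ I).
have [fxd fdE] := fd.
have : h^-1 *: ((f \o shift x) (h *: 1) - f x) @[h --> 0^'] --> d.
  by rewrite -fdE; exact: fxd.
move=> /cvgrPdist_le /(_ e e0); rewrite near_withinE => H.
rewrite (near_shift 0) subr0; near=> h => _ /=.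
have [->|h0] := eqVneq h 0;
  first by rewrite add0r !subrr mulr0 subr0 normr0 mulr0.
rewrite [X in e * `|X|]addrK -ler_pdivrMr ?normr_gt0// -E// distrC.
by move: h0; near: h.
Unshelve. all: by end_near. Qed.

Lemma has_derive_is_derive A f x d : is_derive x 1 f d -> has_derive A f x d.
Proof. by move=> /has_deriveTP; exact: sub_has_derive. Qed.

(** Composing [f] with the projection of the line onto [a, b] turns a relative
    derivative 0 into a two-sided derivative 0 on the whole line. *)
Lemma has_derive0_cst A f a b : a <= b -> `[a, b] `<=` A ->
  (forall x, a <= x <= b -> has_derive A f x 0) -> f b = f a.
Proof.
(* the projection onto [a, b], a 1-Lipschitz map *)
move=> ab abA f0; pose cl x := Num.min b (Num.max a x).
have cl_in x : a <= cl x <= b.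
  by rewrite /cl le_min ab le_max lexx/= ge_min lexx.
have cl_lip x y : `|cl y - cl x| <= `|y - x|.
  have := ler_norm (y - x); have := ler_norm (x - y); rewrite distrC ler_norml.
  rewrite /cl; case: (leP a x) => ?; case: (leP a y) => ?;
    (case: (leP b) => ?); (try case: (leP b) => ?); move=> ? ?; apply/andP;
      split; lra.
have g0 x : is_derive x 1 (f \o cl) 0.
  apply/has_deriveTP => e e0.
  have : \forall y \near cl x, A y -> `|f y - f (cl x) - 0 * (y - cl x)| <=
    e * `|y - cl x|.
    exact: f0.
  case/nbhs_ballP => r /= r0 H; near=> y => _ /=; rewrite mul0r subr0.
  have yx : `|y - x| < r by near: y; exact: near_dist.
  have := H (cl y); rewrite /ball/= distrC mul0r subr0.
  move=> /(_ (le_lt_trans (cl_lip _ _) yx)) h.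
  apply: le_trans (h _) _; first by apply: abA; rewrite /= in_itv/= cl_in.
  exact: ler_wpM2l (ltW e0) _ _ (cl_lip _ _).
have /= := is_derive_0_is_cst b a g0.
by rewrite /cl maxxx (max_idPr ab) minxx (min_idPr ab).
Unshelve. all: by end_near. Qed.

(** Each point of [a, b], an endpoint included, is a limit of other points of
    [a, b]. *)
Lemma has_derive_uniq A f a b x d d' : a < b -> `[a, b] `<=` A -> a <= x <= b ->
  has_derive A f x d -> has_derive A f x d' -> d = d'.
Proof.
move=> ab abA axb fd fd'; apply/eqP; rewrite -subr_eq0 -normr_le0.
apply/ler_addgt0Pr => e e0; rewrite add0r.
have := has_deriveB fd fd' => /(_ e e0); rewrite -/(nbhs _ _).
case/nbhs_ballP => r /= r0 H.
have [ax xb0] := andP axb.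
have [y [yab yx ynx]] : exists y, [/\ a <= y <= b, `|y - x| < r & y != x].
  have [xb|bx] := ltP x b.
    exists (Num.min b (x + r / 2)); split.
    - by case: (leP b) => ?; apply/andP; split; lra.
    - by case: (leP b) => ?; rewrite ltr_norml; apply/andP; split; lra.
    - by case: (leP b) => ?; apply/eqP; lra.
  exists (Num.max a (x - r / 2)); split.
  - by case: (leP a (x - r / 2)) => ?; apply/andP; split; lra.
  - by case: (leP a (x - r / 2)) => ?; rewrite ltr_norml; apply/andP; split;
    lra.
  - by case: (leP a (x - r / 2)) => ?; apply/eqP; lra.
have := H y; rewrite /ball/= distrC => /(_ yx); have Ay : A y by exact: abA.
move=> /(_ Ay);
  rewrite !subrr sub0r normrN normrM ler_pM2r// normr_gt0 subr_eq0//.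
Qed.

Lemma has_derive_uniq0 f x d d' : 0 <= x ->
  has_derive `[0, +oo[ f x d -> has_derive `[0, +oo[ f x d' -> d = d'.
Proof.
move=> x0; apply: (@has_derive_uniq _ _ x (x + 1)).
- by rewrite ltrDl.
- by move=> y /=; rewrite !in_itv/= andbT => /andP[xy _]; exact: le_trans xy.
- by rewrite lexx/= lerDl.
Qed.

Lemma has_derive_eq A f g h a b : a <= b -> `[a, b] `<=` A ->
  (forall x, a <= x <= b -> has_derive A f x (h x)) ->
  (forall x, a <= x <= b -> has_derive A g x (h x)) ->
  f b - f a = g b - g a.
Proof.
move=> ab abA fh gh.
have := @has_derive0_cst A (fun y => f y - g y) a b ab abA.
have H x : a <= x <= b -> has_derive A (fun y => f y - g y) x 0.
  by move=> xab; rewrite -(subrr (h x)); apply: has_deriveB;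
    [exact: fh|exact: gh].
by move=> /(_ H); lra.
Qed.

Lemma has_deriveX A n x : has_derive A (fun y => y ^+ n.+1 / n.+1%:R) x
  (x ^+ n).
Proof.
have h := @is_deriveX R R id n.+1 x 1 1 (is_derive_id _ _).
have -> : (fun y : R => y ^+ n.+1 / n.+1%:R) =
  (fun y => n.+1%:R^-1 * y ^+ n.+1).
  by apply/funext => y; rewrite mulrC.
have -> : x ^+ n = n.+1%:R^-1 * (n.+1%:R * x ^+ n).
  by rewrite mulKf// pnatr_eq0.
apply/has_deriveZ/has_derive_is_derive; move: h; rewrite exprfctE.
by rewrite -[_ *: 1]/(_ * 1) mulr1.
Qed.

(** The remainder is uniform in the space variable: this is what a derivative
    in the energy norm provides, and it spares [transport] any continuity of
    [G] in time. *)
Definition uniform_derive (X : set R) (F G : R -> R -> R) := forall t, 0 <= t ->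
  forall e, 0 < e -> \forall s \near t, 0 <= s ->
    forall x, X x -> `|F s x - F t x - G t x * (s - t)| <= e * `|s - t|.

Lemma uniform_derive_has_derive X F G x : uniform_derive X F G -> X x ->
  forall t, 0 <= t -> has_derive `[0, +oo[ (fun s => F s x) t (G t x).
Proof.
move=> FG Xx t t0 e e0; apply: filterS (FG t t0 e e0) => s H /=.
by rewrite in_itv/= andbT => /H; exact.
Qed.

Lemma uniform_derive_at (L : R) F G x t : uniform_derive `[0, L] F G ->
  0 <= x <= L -> 0 <= t -> has_derive `[0, +oo[ (F ^~ x) t (G t x).
Proof.
move=> FG xL; apply: (uniform_derive_has_derive FG (x := x)).
by rewrite /= in_itv.
Qed.

Lemma uniform_deriveD X F G F' G' : uniform_derive X F G ->
  uniform_derive X F' G' ->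
  uniform_derive X (fun t x => F t x + F' t x) (fun t x => G t x + G' t x).
Proof.
move=> FG FG' t t0 e e0; have e2 : 0 < e / 2 by rewrite divr_gt0.
near=> s => s0 x Xx.
have /(_ s0 x Xx) h1 : 0 <= s -> forall x, X x ->
  `|F s x - F t x - G t x * (s - t)| <= e / 2 * `|s - t|.
  by near: s; exact: (FG t t0 _ e2).
have /(_ s0 x Xx) h2 : 0 <= s -> forall x, X x ->
  `|F' s x - F' t x - G' t x * (s - t)| <= e / 2 * `|s - t|.
  by near: s; exact: (FG' t t0 _ e2).
rewrite [X in `|X|](_ : _ = (F s x - F t x - G t x * (s - t)) +
  (F' s x - F' t x - G' t x * (s - t))); last by ring.
by rewrite (le_trans (ler_normD _ _))// (splitr e) mulrDl lerD.
Unshelve. all: by end_near. Qed.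

Lemma uniform_deriveZ X F G k : uniform_derive X F G ->
  uniform_derive X (fun t x => k * F t x) (fun t x => k * G t x).
Proof.
move=> FG t t0 e e0; have k1 : 0 < 1 + `|k| by rewrite ltr_pwDl.
near=> s => s0 x Xx.
have /(_ s0 x Xx) h1 : 0 <= s -> forall x, X x ->
  `|F s x - F t x - G t x * (s - t)| <= e / (1 + `|k|) * `|s - t|.
  by near: s; exact: (FG t t0 _ (divr_gt0 e0 k1)).
rewrite -mulrBr -mulrA -mulrBr normrM.
rewrite (le_trans (ler_wpM2l _ h1))// mulrA ler_wpM2r//.
by rewrite mulrCA ler_piMr ?(ltW e0)// ler_pdivrMr// mul1r lerDr.
Unshelve. all: by end_near. Qed.

Lemma uniform_derive_cst X (F : R -> R) : uniform_derive X (fun _ x =>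
  F x) (fun _ _ => 0).
Proof.
by move=> t t0 e e0; near=> s => _ x _;
  rewrite subrr mul0r subr0 normr0 mulr_ge0// ltW.
Unshelve. all: by end_near. Qed.

Lemma has_derive_uniform X f g : (forall t, 0 <= t ->
  has_derive `[0, +oo[ f t (g t)) ->
  uniform_derive X (fun t _ => f t) (fun t _ => g t).
Proof.
move=> fg t t0 e e0; apply: filterS (fg t t0 e e0) => s H s0 _ _.
by apply: H; rewrite /= in_itv/= s0.
Qed.

(** The chain rule: [Dx = k * Dt] says that x |-> D (t - k * x) x has derivative
    0, that is, [D] is constant along the characteristics of slope [- k].
    Moving in space first and then in time at the final abscissa, only the
    continuity of [Dt] in space enters. *)
Lemma transport (L k : R) (D Dt Dx : R -> R -> R) :
  uniform_derive `[0, L] D Dt ->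
  (forall t x, 0 <= t -> 0 <= x <= L -> has_derive `[0, L] (D t) x (Dx t x)) ->
  (forall t x, 0 <= t -> 0 <= x <= L -> cont_in `[0, L] (Dt t) x) ->
  (forall t x, 0 <= t -> 0 <= x <= L -> Dx t x = k * Dt t x) ->
  forall t a b, 0 <= a -> a <= b -> b <= L ->
    0 <= t - k * a -> 0 <= t - k * b -> D (t - k * a) a = D (t - k * b) b.
Proof.
move=> DDt DDx Dtc DxE t a b a0 ab bL ta tb.
have L0 x : a <= x <= b -> 0 <= x <= L by lra.
have T0 x : a <= x <= b -> 0 <= t - k * x.
  by move=> axb; have [k0|k0] := leP 0 k; nra.
apply/esym/(@has_derive0_cst `[a, b] (fun x => D (t - k * x) x)) =>
  // x xab e e0.
have x0L := L0 _ xab; have tx := T0 _ xab.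
set s := fun y => t - k * y.
have k1 : 0 < 1 + `|k| by rewrite ltr_pwDl.
pose e' := e / (2 * (1 + `|k|)).
have e'0 : 0 < e' by rewrite divr_gt0// mulr_gt0.
have scvg : s y @[y --> x] --> s x.
  by apply: cvgB; [exact: cvg_cst|apply: cvgM; [exact: cvg_cst|exact: cvg_id]].
near=> y => yab; have {}yab : a <= y <= b by move: yab; rewrite /= in_itv.
have y0L := L0 _ yab; have ty := T0 _ yab.
have h1 : `|D (s y) y - D (s x) y - Dt (s x) y * (s y - s x)| <=
  e' * `|s y - s x|.
  have : 0 <= s y -> forall z, `[0, L]%classic z ->
    `|D (s y) z - D (s x) z - Dt (s x) z * (s y - s x)| <= e' * `|s y - s x|.
    by near: y; exact: (scvg _ (DDt (s x) tx _ e'0)).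
  by move=> /(_ ty y); apply; rewrite /= in_itv.
have h2 : `|D (s x) y - D (s x) x - Dx (s x) x * (y - x)| <= e' * `|y - x|.
  have : `[0, L]%classic y -> `|D (s x) y - D (s x) x - Dx (s x) x * (y - x)| <=
    e' * `|y - x|.
    by near: y; exact: DDx.
  by apply; rewrite /= in_itv.
have h3 : `|Dt (s x) y - Dt (s x) x| <= e'.
  have : `[0, L]%classic y -> `|Dt (s x) y - Dt (s x) x| <= e'.
    by near: y; exact: Dtc.
  by apply; rewrite /= in_itv.
rewrite DxE// in h2.
have sE : s y - s x = - k * (y - x) by rewrite /s; ring.
rewrite sE in h1.
rewrite mul0r subr0 -/(s y) -/(s x).
rewrite (_ : D (s y) y - _ =
  (D (s y) y - D (s x) y - Dt (s x) y * (- k * (y - x))) +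
  (D (s x) y - D (s x) x - k * Dt (s x) x * (y - x)) +
    (Dt (s x) y - Dt (s x) x) * (- k * (y - x))); last by ring.
have h4 : `|(Dt (s x) y - Dt (s x) x) * (- k * (y - x))| <=
  e' * `|- k * (y - x)|.
  by rewrite normrM ler_wpM2r.
rewrite (le_trans (ler_normD _ _))//
  (le_trans (lerD (ler_normD _ _) (lexx _)))//.
rewrite (le_trans (lerD (lerD h1 h2) h4))// normrM normrN.
have -> : e = e' * (2 * (1 + `|k|)) by rewrite /e' divfK// mulf_neq0// gt_eqF.
have -> : e' * (`|k| * `|y - x|) + e' * `|y - x| + e' * (`|k| * `|y - x|) =
  e' * (1 + 2 * `|k|) * `|y - x| by ring.
by rewrite ler_wpM2r// ler_wpM2l ?(ltW e'0)//; have := normr_ge0 k; lra.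
Unshelve. all: by end_near. Qed.

End RelativeDerivatives.

(** * Sliding solutions of the integrated system vanish *)

Section SlidingDynamics.
Variable R : realType.

Lemma eqfun_has_derive (A : set R) (f g : R -> R) x d d' : f =1 g -> d = d' ->
  has_derive A f x d -> has_derive A g x d'.
Proof. by move=> /funext -> ->. Qed.

Lemma time_itv (b : R) : `[0, b] `<=` `[0, +oo[.
Proof. by move=> x /=; rewrite !in_itv/= andbT => /andP[]. Qed.

Lemma time_integrate (f g F : R -> R) :
  (forall t, 0 <= t -> has_derive `[0, +oo[ f t (g t)) ->
  (forall t, 0 <= t -> has_derive `[0, +oo[ F t (g t)) ->
  forall t, 0 <= t -> f t = f 0 + (F t - F 0).
Proof.
move=> fg Fg t t0; have :=
  @has_derive_eq _ `[0, +oo[ f F g 0 t t0 (@time_itv t).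
have H x : 0 <= x <= t -> 0 <= x by case/andP.
by move=> /(_ (fun x h => fg x (H x h)) (fun x h => Fg x (H x h))); lra.
Qed.

Lemma space_integrate (L : R) (f g F : R -> R) :
  (forall x, 0 <= x <= L -> has_derive `[0, L] f x (g x)) ->
  (forall x, 0 <= x <= L -> has_derive `[0, L] F x (g x)) ->
  forall x, 0 <= x <= L -> f x = f 0 + (F x - F 0).
Proof.
move=> fg Fg x /andP[x0 xL].
have s : `[0, x] `<=` `[0, L].
  by move=> y /=; rewrite !in_itv/= => /andP[-> yx]; exact: le_trans yx xL.
have := @has_derive_eq _ `[0, L] f F g 0 x x0 s.
have H y : 0 <= y <= x -> 0 <= y <= L by move=> /andP[-> yx];
  exact: le_trans yx xL.
by move=> /(_ (fun x h => fg x (H x h)) (fun x h => Fg x (H x h))); lra.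
Qed.

Lemma eq_time_derive (f g : R -> R) t d d' : 0 <= t ->
  (forall s, 0 <= s -> f s = g s) -> d = d' ->
  has_derive `[0, +oo[ f t d -> has_derive `[0, +oo[ g t d'.
Proof.
move=> t0 fg ->; apply: eq_has_derive; first by rewrite /= in_itv/= t0.
by move=> s; rewrite inE/= in_itv/= andbT; exact: fg.
Qed.

(** [V] stands for one component of the time integral U of a mild solution u,
    [v] for the same component of u, [M] for the primitive in space of the
    velocity of U, and [n] for that of the velocity of u. As A U = u - u(0), the
    velocity of U is v - v(0), whence [mom_x]. Replacing velocities by their
    primitives turns classes of square integrable functions into continuous
    functions. *)
Record kinematics (L : R) (V v Vx M n : R -> R -> R) : Prop := Kinematics {
  disp_init : forall x, 0 <= x <= L -> V 0 x = 0 ;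
  disp_t : uniform_derive `[0, L] V v ;
  disp_x : forall t x, 0 <= t -> 0 <= x <= L ->
    has_derive `[0, L] (V t) x (Vx t x) ;
  disp_0 : forall t, 0 <= t -> V t 0 = 0 ;
  mom_t : uniform_derive `[0, L] M n ;
  mom_x : forall t x, 0 <= t -> 0 <= x <= L ->
    has_derive `[0, L] (M t) x (v t x - v 0 x) ;
  mom_0 : forall t, 0 <= t -> M t 0 = 0 }.

(** The equation r v_tt = v_xx, integrated over [0, t] in time and over [0, x]
    in space. *)
Definition wave_equation (L r : R) (Vx n : R -> R -> R) :=
  forall t x, 0 <= t -> 0 <= x <= L ->
    Vx t x - Vx t 0 = r * (n t x - n 0 x).

Lemma kinematics_at_rest (L : R) V v Vx M n : 0 < L ->
  kinematics L V v Vx M n ->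
  (forall t x, 0 <= t -> 0 <= x <= L -> V t x = 0) ->
  forall t x, 0 <= t -> 0 <= x <= L -> [/\ v t x = 0, n t x = 0 & Vx t x = 0].
Proof.
move=> L0 [Vi Vt Vxx V0 Mt Mx M0] VE.
have cst0 t : has_derive `[0, +oo[ (fun=> 0) t (0 : R) by exact: has_derive_cst.
have vE t x : 0 <= t -> 0 <= x <= L -> v t x = 0.
  move=> t0 xL; apply: (has_derive_uniq0 t0 (uniform_derive_at Vt xL t0)).
  by apply: eq_time_derive (cst0 t) => // s s0; rewrite VE.
have ME t x : 0 <= t -> 0 <= x <= L -> M t x = 0.
  move=> t0 xL; rewrite (@space_integrate L (M t) (fun x => v t x - v 0 x)
    (fun=> 0) _ _ x xL).
  - by rewrite M0// subrr addr0.
  - by move=> y yL; exact: Mx.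
  - by move=> y yL; rewrite !vE// subrr; exact: has_derive_cst.
move=> t x t0 xL; split; first exact: vE.
- apply: (has_derive_uniq0 t0 (uniform_derive_at Mt xL t0)).
  by apply: eq_time_derive (cst0 t) => // s s0; rewrite ME.
- apply: (has_derive_uniq L0 (@subset_refl _ _) xL (Vxx t x t0 xL)).
  apply: eq_has_derive (has_derive_cst `[0, L] 0 x); first by rewrite /= in_itv.
  by move=> y; rewrite inE/= in_itv/= => yL; rewrite VE.
Qed.

(** The hypothesis on [n] makes V_x quadratic in space, so
    V = a(t) x + b(t) x^3. The wave equation then reads b''' = 0,
    a''' = (6 / r) b', so that a and b are polynomials in t of degrees at most
    4 and 2, and the damping condition at [L] kills their coefficients one
    after the other, from the highest degree down. *)
Lemma cubic_wave_at_rest (L r eta : R) V v Vx M n (d : R -> R) :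
  0 < L -> 0 < r -> 0 < eta -> kinematics L V v Vx M n ->
    wave_equation L r Vx n ->
  (forall t, 0 <= t -> Vx t L = - eta * (v t L - v 0 L)) ->
  (forall t x, 0 <= t -> 0 <= x <= L -> n t x - n 0 x = d t * x ^+ 2) ->
  forall t x, 0 <= t -> 0 <= x <= L -> V t x = 0.
Proof.
move=> L0 r0 eta0 [Vi Vt Vxx V0 Mt Mx M0] eqn bc dE.
have LL : 0 <= L <= L by apply/andP; split; lra.
have Lh : 0 <= L / 2 <= L by apply/andP; split; lra.
pose a t := Vx t 0; pose b t := r * d t / 3.
have VE t x : 0 <= t -> 0 <= x <= L -> V t x = a t * x + b t * x ^+ 3.
  move=> t0 xL.
  have := @space_integrate L (V t) (Vx t) (fun x => a t * (x ^+ 1 / 1%:R) +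
    r * d t * (x ^+ 3 / 3%:R)).
  move=> /(_ (fun x => Vxx t x t0))->//; first by rewrite V0// /b; field.
  move=> y yL; have -> : Vx t y = a t * y ^+ 0 + r * d t * y ^+ 2.
    by rewrite -mulrA -dE// -eqn// /a expr0; ring.
  by apply: has_deriveD; apply: has_deriveZ; exact: has_deriveX.
(* [a] and [b], hence their derivatives, are recovered from the values of the
   wave at L and L / 2 *)
pose a1 t := (8 * v t (L / 2) - v t L) / (3 * L).
pose b1 t := 4 * (v t L - 2 * v t (L / 2)) / (3 * L ^+ 3).
have Lne : L != 0 by rewrite gt_eqF.
have at_ t : 0 <= t -> has_derive `[0, +oo[ a t (a1 t).
  move=> t0; have :=
    has_deriveZ (3 * L)^-1
    (has_deriveB (has_deriveZ 8 (uniform_derive_at Vt Lh t0))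
    (uniform_derive_at Vt LL t0)).
  apply: eq_time_derive => // [s s0|].
    by rewrite !VE//; field.
  by rewrite /a1 /b1; field.
have bt_ t : 0 <= t -> has_derive `[0, +oo[ b t (b1 t).
  move=> t0; have := has_deriveZ (4 / (3 * L ^+ 3))
    (has_deriveB (uniform_derive_at Vt LL t0)
    (has_deriveZ 2 (uniform_derive_at Vt Lh t0))).
  apply: eq_time_derive => // [s s0|].
    by rewrite !VE//; field.
  by rewrite /a1 /b1; field.
have vE t x : 0 <= t -> 0 <= x <= L -> v t x = a1 t * x + b1 t * x ^+ 3.
  move=> t0 xL; apply: (has_derive_uniq0 t0 (uniform_derive_at Vt xL t0)).
  have := has_deriveD (has_deriveZ x (at_ t t0)) (has_deriveZ (x ^+ 3)
    (bt_ t t0)).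
  apply: eq_time_derive => // [s s0|].
    by rewrite VE//; ring.
  by ring.
have ME t x : 0 <= t -> 0 <= x <= L ->
    M t x = (a1 t - a1 0) * x ^+ 2 / 2 + (b1 t - b1 0) * x ^+ 4 / 4.
  move=> t0 xL.
  have := @space_integrate L (M t) (fun x => v t x - v 0 x)
    (fun x => (a1 t - a1 0) * (x ^+ 2 / 2%:R) +
      (b1 t - b1 0) * (x ^+ 4 / 4%:R)).
  move=> /(_ (fun x => Mx t x t0))->//; first by rewrite M0//; field.
  move=> y yL; have -> : v t y - v 0 y = (a1 t - a1 0) * y ^+ 1 +
    (b1 t - b1 0) * y ^+ 3.
    by rewrite !vE//; ring.
  by apply: has_deriveD; apply: has_deriveZ; exact: has_deriveX.
(* in the same way from [M], which is
   (a1 - a1(0)) x^2 / 2 + (b1 - b1(0)) x^4 / 4 *)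
pose a2 t := 2 / (3 * L ^+ 2) * (16 * n t (L / 2) - n t L).
pose b2 t := 16 / (3 * L ^+ 4) * (n t L - 4 * n t (L / 2)).
have a1t t : 0 <= t -> has_derive `[0, +oo[ a1 t (a2 t).
  move=> t0; have := has_deriveD (has_derive_cst _ (a1 0) _)
    (has_deriveZ (2 / (3 * L ^+ 2))
    (has_deriveB (has_deriveZ 16 (uniform_derive_at Mt Lh t0))
    (uniform_derive_at Mt LL t0))).
  apply: eq_time_derive => // [s s0|].
    by rewrite !ME//; field.
  by rewrite /a2 /b2; field.
have b1t t : 0 <= t -> has_derive `[0, +oo[ b1 t (b2 t).
  move=> t0; have := has_deriveD (has_derive_cst _ (b1 0) _)
    (has_deriveZ (16 / (3 * L ^+ 4)) (has_deriveB (uniform_derive_at Mt LL t0)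
    (has_deriveZ 4 (uniform_derive_at Mt Lh t0)))).
  apply: eq_time_derive => // [s s0|].
    by rewrite !ME//; field.
  by rewrite /a2 /b2; field.
have nE t x : 0 <= t -> 0 <= x <= L -> n t x = n 0 x + 3 * b t / r * x ^+ 2.
  by move=> t0 xL; rewrite -[LHS](subrK (n 0 x)) dE// /b; field; rewrite gt_eqF.
have rne : r != 0 by rewrite gt_eqF.
have b2E t : 0 <= t -> b2 t = b2 0.
  by move=> t0; rewrite /b2 (nE t L)// (nE t (L / 2))//; field; apply/andP.
have a2E t : 0 <= t -> a2 t = a2 0 + 6 / r * b t.
  by move=> t0; rewrite /a2 (nE t L)// (nE t (L / 2))//; field; apply/andP.
have ab0 : a 0 = 0 /\ b 0 = 0.
  have h1 : V 0 L = 0 by exact: Vi.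
  have h2 : V 0 (L / 2) = 0 by exact: Vi.
  rewrite VE// in h1; rewrite VE// in h2.
  split.
    have : a 0 * (3 * L) = 0.
      have -> : a 0 * (3 * L) = 8 * (a 0 * (L / 2) + b 0 * (L / 2) ^+ 3) -
        (a 0 * L + b 0 * L ^+ 3) by field.
      by rewrite h1 h2; ring.
    by move=> /eqP; rewrite !mulf_eq0 (negbTE Lne) pnatr_eq0/= !orbF => /eqP.
  have : b 0 * (3 * L ^+ 3) = 0.
    have -> : b 0 * (3 * L ^+ 3) =
      4 * ((a 0 * L + b 0 * L ^+ 3) - 2 * (a 0 * (L / 2) + b 0 * (L / 2) ^+ 3))
      by field.
    by rewrite h1 h2; ring.
  have L3 : 3 * L ^+ 3 != 0 by rewrite mulf_neq0 ?pnatr_eq0 ?expf_neq0.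
  by move=> /eqP; rewrite mulf_eq0 (negbTE L3) orbF => /eqP.
case: ab0 => a00 b00.
set B0 := b1 0; set B1 := b2 0; set A0 := a1 0; set A2 := a2 0.
have b1E t : 0 <= t -> b1 t = B0 + B1 * t.
  move=> t0; rewrite (@time_integrate b1 b2 (fun t =>
    B1 * (t ^+ 1 / 1%:R)) b1t _ t t0) /=.
    by rewrite /B0; field.
  by move=> s s0; rewrite b2E// -[b2 0]mulr1 -(expr0 s); apply: has_deriveZ;
    exact: has_deriveX.
have bE t : 0 <= t -> b t = B0 * t + B1 * t ^+ 2 / 2.
  move=> t0; rewrite (@time_integrate b b1 (fun t => B0 * (t ^+ 1 / 1%:R) +
    B1 * (t ^+ 2 / 2%:R)) bt_ _ t t0) /=.
    by rewrite b00; field.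
  move=> s s0; rewrite b1E// -[in B0 + _](mulr1 B0) -(expr0 s) -[in B1 *
    s](expr1 s).
  by apply: has_deriveD; apply: has_deriveZ; exact: has_deriveX.
have a1E t : 0 <= t -> a1 t = A0 + A2 * t + 6 / r * (B0 * t ^+ 2 / 2 +
  B1 * t ^+ 3 / 6).
  move=> t0; rewrite (@time_integrate a1 a2 (fun t => A2 * (t ^+ 1 / 1%:R) +
    (6 / r * B0) * (t ^+ 2 / 2%:R) + (6 / r * B1 / 2) * (t ^+ 3 / 3%:R)) a1t _ t
    t0) /=.
    by rewrite /A0; field.
  move=> s s0; rewrite a2E// bE//.
  have -> : a2 0 + 6 / r * (B0 * s + B1 * s ^+ 2 / 2) =
    A2 * s ^+ 0 + (6 / r * B0) * s ^+ 1 + (6 / r * B1 / 2) * s ^+ 2.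
    by rewrite expr0 expr1 /A2; field.
  by do ![apply: has_deriveD]; apply: has_deriveZ; exact: has_deriveX.
have aE t : 0 <= t -> a t = A0 * t + A2 * t ^+ 2 / 2 +
  6 / r * (B0 * t ^+ 3 / 6 + B1 * t ^+ 4 / 24).
  move=> t0; rewrite (@time_integrate a a1 (fun t => A0 * (t ^+ 1 / 1%:R) +
    A2 * (t ^+ 2 / 2%:R) + (6 / r * B0 / 2) * (t ^+ 3 / 3%:R) +
    (6 / r * B1 / 6) * (t ^+ 4 / 4%:R)) at_ _ t t0) /=.
    by rewrite a00; field.
  move=> s s0; rewrite a1E//.
  have -> : A0 + A2 * s + 6 / r * (B0 * s ^+ 2 / 2 + B1 * s ^+ 3 / 6) =
    A0 * s ^+ 0 + A2 * s ^+ 1 + (6 / r * B0 / 2) * s ^+ 2 +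
    (6 / r * B1 / 6) * s ^+ 3.
    by rewrite expr0 expr1; field.
  by do ![apply: has_deriveD]; apply: has_deriveZ; exact: has_deriveX.
(* the coefficients of the damping condition, a polynomial in t without
   constant term; its values at t = 1, 2, 3, 4 determine them *)
pose X4 := B1 / (4 * r).
pose X3 := B0 / r + eta * L * B1 / r.
pose X2 := A2 / 2 + 3 * L ^+ 2 * B1 / 2 + 3 * eta * L * B0 / r.
pose X1 := A0 + 3 * L ^+ 2 * B0 + eta * L * A2 + eta * L ^+ 3 * B1.
have bcE t : 0 <= t -> X4 * t ^+ 4 + X3 * t ^+ 3 + X2 * t ^+ 2 + X1 * t = 0.
  move=> t0; have : Vx t L + eta * (v t L - v 0 L) = 0 by rewrite bc//; ring.
  have -> : Vx t L = a t + 3 * b t * L ^+ 2.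
    have := eqn t L t0 LL; rewrite dE// => h.
    by rewrite -[LHS](subrK (Vx t 0)) h /b /a; field.
  rewrite !vE// (a1E t)// (aE t)// (b1E t)// (bE t)// -/A0 -/B0 => <-.
  by rewrite /X1 /X2 /X3 /X4; field.
have e1 := bcE 1 ltac:(lra); have e2 := bcE 2 ltac:(lra).
have e3 := bcE 3 ltac:(lra); have e4 := bcE 4 ltac:(lra).
have x4 : X4 = 0 by lra.
have x3 : X3 = 0 by lra.
have x2 : X2 = 0 by lra.
have x1 : X1 = 0 by lra.
have B10 : B1 = 0 by rewrite -(mul0r (4 * r)) -x4 /X4; field.
have B00 : B0 = 0.
  by rewrite -(mul0r r) -x3 /X3 B10; field.
have A20 : A2 = 0 by move: x2; rewrite /X2 B10 B00 !(mulr0, mul0r, addr0); lra.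
have A00 : A0 = 0 by move: x1; rewrite /X1 B10 B00 A20 !(mulr0, mul0r, addr0).
move=> t x t0 xL; rewrite VE// aE// bE// B10 B00 A00 A20.
by ring.
Qed.

(** Both Cauchy data of the wave at x = L are polynomials in time. Its two
    d'Alembert components carry them along the characteristics to x = 0, where
    the Dirichlet condition gives a polynomial identity that only zero data
    satisfy. With zero data at x = L, one component vanishes everywhere, hence
    so does the other one at x = 0 and, by transport, everywhere. *)
Lemma linear_trace_wave_at_rest (L r eta nu c0 c1 : R) V v Vx M n (Rv Rn : R ->
  R) :
  0 < L -> 0 < r -> 0 < eta -> 0 < nu -> kinematics L V v Vx M n ->
    wave_equation L r Vx n ->
  (forall t x, 0 <= t -> 0 <= x <= L -> cont_in `[0, L] (v t) x) ->
  (forall t x, 0 <= t -> 0 <= x <= L -> cont_in `[0, L] (n t) x) ->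
  (forall x, 0 <= x <= L -> has_derive `[0, L] Rv x (v 0 x)) ->
  (forall x, 0 <= x <= L -> has_derive `[0, L] Rn x (n 0 x)) ->
  (forall t, 0 <= t -> Vx t L = - eta * (v t L - v 0 L)) ->
  (forall t, 0 <= t -> Vx t L = nu * (c0 * t + c1 * t ^+ 2 / 2)) ->
  forall t x, 0 <= t -> 0 <= x <= L -> V t x = 0.
Proof.
move=> L0 r0 eta0 nu0 [Vi Vt Vxx V0 Mt Mx M0] eqn cv cn RvE RnE bc VxL.
have LL : 0 <= L <= L by apply/andP; split; lra.
have L00 : 0 <= (0 : R) <= L by apply/andP; split; lra.
(* nu * W is the primitive in time of V_x(t, L) *)
pose W t := c0 * (t ^+ 2 / 2) + c1 / 2 * (t ^+ 3 / 3).
have WE t : has_derive `[0, +oo[ W t (c0 * t + c1 * t ^+ 2 / 2).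
  have -> : c0 * t + c1 * t ^+ 2 / 2 =
    c0 * t ^+ 1 + c1 / 2 * t ^+ 2 by rewrite expr1; field.
  by apply: has_deriveD; apply: has_deriveZ; exact: has_deriveX.
have rne : r != 0 by rewrite gt_eqF.
have ene : eta != 0 by rewrite gt_eqF.
set v0 := v 0 L.
have VL t : 0 <= t -> V t L = v0 * t - nu / eta * W t.
  move=> t0.
  rewrite (@time_integrate (V ^~ L) (v ^~ L) (fun t => v0 * (t ^+ 1 / 1%:R) -
    nu / eta * W t) (fun s => uniform_derive_at (t := s) Vt LL) _ t t0) /=.
    by rewrite Vi// /W; field.
  move=> s s0.
  have -> : v s L = v0 * s ^+ 0 - nu / eta * (c0 * s + c1 * s ^+ 2 / 2).
    have h := bc s s0; rewrite VxL// in h.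
    by rewrite -mulrA mulrCA h /v0 expr0; field.
  by apply: has_deriveB; apply: has_deriveZ; [exact: has_deriveX|exact: WE].
(* [Q] absorbs the inhomogeneity due to the initial velocity: with
   N = M(t, x) - M(t, L) + Rv(x) - Rv(L) + nu W / r, one has (V + Q)_t = N_x and
   (V + Q)_x = r N_t, so V + Q + k N is a d'Alembert component if k^2 = r *)
pose Q x := r * (Rn x - Rn L) - r * n 0 L * (x - L).
pose D k t x := (V t x + Q x) + k * ((M t x - M t L + (Rv x - Rv L)) +
  nu / r * W t).
pose Dt k t x := v t x + k * (n t x - n t L + Vx t L / r).
pose Dx k t x := Vx t x + r * (n 0 x - n 0 L) + k * v t x.
have DDt k : uniform_derive `[0, L] (D k) (Dt k).
  have ML : uniform_derive `[0, L] (fun t _ => M t L) (fun t _ => n t L).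
    by apply: has_derive_uniform => t t0; exact: (uniform_derive_at Mt LL).
  have WU : uniform_derive `[0, L] (fun t _ => W t) (fun t _ =>
    c0 * t + c1 * t ^+ 2 / 2).
    by apply: has_derive_uniform => t t0; exact: WE.
  have := uniform_deriveD (uniform_deriveD Vt (@uniform_derive_cst R `[0, L] Q))
    (uniform_deriveZ k
      (uniform_deriveD
      (uniform_deriveD (uniform_deriveD Mt (uniform_deriveZ (-1) ML))
      (@uniform_derive_cst R `[0, L] (fun x => Rv x - Rv L)))
        (uniform_deriveZ (nu / r) WU))).
  move=> H t t0 e e0; apply: filterS (H t t0 e e0) => s K s0 x xL.
  have := K s0 x xL; congr (`|_| <= _); rewrite /D /Dt VxL//; field.
  by rewrite rne.
have DDx k t x : 0 <= t -> 0 <= x <= L ->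
  has_derive `[0, L] (D k t) x (Dx k t x).
  move=> t0 xL.
  have := has_deriveD (has_deriveD (Vxx t x t0 xL)
    (has_deriveB (has_deriveZ r (RnE x xL))
    (has_deriveZ (r * n 0 L) (@has_deriveX _ `[0, L] 0 x))))
    (has_deriveD (has_deriveZ k (has_deriveD (Mx t x t0 xL) (RvE x xL)))
     (has_derive_cst `[0, L] (- r * Rn L + r * n 0 L * L + k * (- M t L - Rv L +
       nu / r * W t)) x)).
  by apply: eqfun_has_derive => [y|]; rewrite /D /Dx /Q; field.
have Dtc k t x : 0 <= t -> 0 <= x <= L -> cont_in `[0, L] (Dt k t) x.
  move=> t0 xL e e0; have k1 : 0 < 1 + `|k| by rewrite ltr_pwDl.
  have e1 : 0 < e / (1 + `|k|) by rewrite divr_gt0.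
  near=> y => Ly.
  have /(_ Ly) h1 : `[0, L]%classic y -> `|v t y - v t x| <= e / (1 + `|k|).
    by near: y; exact: cv.
  have /(_ Ly) h2 : `[0, L]%classic y -> `|n t y - n t x| <= e / (1 + `|k|).
    by near: y; exact: cn.
  have -> : Dt k t y - Dt k t x = (v t y - v t x) +
    k * (n t y - n t x) by rewrite /Dt; ring.
  rewrite (le_trans (ler_normD _ _))// normrM.
  have -> : e = e / (1 + `|k|) + `|k| * (e / (1 + `|k|)) by field;
    rewrite gt_eqF.
  by rewrite lerD// ler_wpM2l.
pose sg := Num.sqrt r.
have sg0 : 0 < sg by rewrite sqrtr_gt0.
have sgr : sg * sg = r by rewrite -expr2 sqr_sqrtr// ltW.
have DxE k : k * k = r -> forall t x, 0 <= t -> 0 <= x <= L -> Dx k t x =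
  k * Dt k t x.
  move=> kr t x t0 xL; have h1 := eqn t x t0 xL; have h2 := eqn t L t0 LL.
  transitivity (k * v t x + (k * k) * (n t x - n t L + Vx t L / r));
    last by rewrite /Dt; ring.
  rewrite kr; have -> : r * (n t x - n t L + Vx t L / r) = r * (n t x - n t L) +
    Vx t L by field.
  rewrite /Dx; lra.
have tr k (kr : k * k = r) := transport (DDt k) (DDx k) (Dtc k) (DxE k kr).
have DL k t : 0 <= t -> D k t L = v0 * t + (k * nu / r - nu / eta) * W t.
  by move=> t0; rewrite /D /Q VL//; field; rewrite rne ene.
have D0 t : 0 <= t -> D sg t 0 + D (- sg) t 0 = 2 * Q 0.
  by move=> t0; rewrite /D V0//; ring.
have sgN : - sg * - sg = r by rewrite mulrNN.
have Dm t x : 0 <= t -> 0 <= x <= L -> D (- sg) t x =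
  D (- sg) (t + sg * (L - x)) L.
  move=> t0 /andP[x0 xL]; have := tr (- sg) sgN (t - sg * x) x L x0 xL (lexx L).
  rewrite !mulNr !opprK subrK => ->//; last by nra.
  by congr D; ring.
have Dp t x : 0 <= t -> 0 <= x <= L -> D sg t x = D sg (t + sg * x) 0.
  move=> t0 /andP[x0 xL]; have := tr sg sgr (t + sg * x) 0 x (lexx 0) x0 xL.
  by rewrite mulr0 subr0 addrK => ->//; rewrite addr_ge0// mulr_ge0// ltW.
(* twice the travel time across [0, L] *)
set tau := 2 * (sg * L).
have tau0 : 0 < tau by rewrite !mulr_gt0.
have key s : 0 <= s -> v0 * s + (sg * nu / r - nu / eta) * W s +
    (v0 * (s + tau) + (- sg * nu / r - nu / eta) * W (s + tau)) = 2 * Q 0.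
  move=> s0; rewrite -DL// -DL; last by rewrite addr_ge0// ltW.
  rewrite Dp// -(D0 (s + sg * L)); last by rewrite addr_ge0// mulr_ge0// ltW.
  have sL : 0 <= s + sg * L by rewrite addr_ge0// mulr_ge0// ltW.
  congr (_ + _); rewrite (Dm _ _ sL L00).
  by rewrite subr0 /tau; congr D; ring.
(* the third, second and first differences of this identity in s isolate c1, c0
   and v0 *)
have k0 := key 0 ltac:(lra); have k1 := key 1 ltac:(lra).
have k2 := key 2 ltac:(lra); have k3 := key 3 ltac:(lra).
pose A := nu / eta.
have A0 : A != 0 by rewrite gt_eqF// divr_gt0.
have c10 : c1 = 0.
  have : - 2 * A * c1 = 0.
    transitivity (2 * Q 0 - 3 * (2 * Q 0) + 3 * (2 * Q 0) - 2 * Q 0);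
      last by ring.
    by rewrite -{1}k3 -{1}k2 -{1}k1 -{1}k0 /W /A; field; rewrite rne ene.
  by move=> /eqP;
    rewrite mulf_eq0 (negbTE (mulf_neq0 _ A0)) ?oppr_eq0 ?pnatr_eq0// => /eqP.
have c00 : c0 = 0.
  have : - 2 * A * c0 = 0.
    transitivity (2 * Q 0 - 2 * (2 * Q 0) + 2 * Q 0); last by ring.
    by rewrite -{1}k2 -{1}k1 -{1}k0 /W /A c10; field; rewrite rne ene.
  by move=> /eqP;
    rewrite mulf_eq0 (negbTE (mulf_neq0 _ A0)) ?oppr_eq0 ?pnatr_eq0// => /eqP.
have W0 t : W t = 0 by rewrite /W c00 c10 !mul0r addr0.
rewrite !W0 in k0 k1.
have v00 : v0 = 0 by lra.
have Q0 : Q 0 = 0 by move: k0; rewrite v00; lra.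
have DL0 k t : 0 <= t -> D k t L = 0.
  by move=> t0; rewrite DL// v00 W0 mul0r mulr0 addr0.
have DmE t x : 0 <= t -> 0 <= x <= L -> D (- sg) t x = 0.
  move=> t0 xL; rewrite Dm// DL0//; case/andP: xL => x0 xL.
  by rewrite addr_ge0// mulr_ge0 ?subr_ge0// ltW.
have DpE t x : 0 <= t -> 0 <= x <= L -> D sg t x = 0.
  move=> t0 xL; have tx : 0 <= t + sg * x.
    by case/andP: xL => x0 _; rewrite addr_ge0// mulr_ge0// ltW.
  by rewrite Dp// -[LHS](addrK (D (- sg) (t + sg * x) 0)) D0// Q0 DmE//; lra.
have VQ t x : 0 <= t -> 0 <= x <= L -> V t x + Q x = 0.
  move=> t0 xL; have := DmE t x t0 xL; have := DpE t x t0 xL; rewrite /D; lra.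
move=> t x t0 xL; have := VQ t x t0 xL; have := VQ 0 x (lexx 0) xL.
by rewrite Vi//; lra.
Unshelve. all: by end_near. Qed.

(** With v1 = v3 = V, eliminating the inertia from the first two equations shows
    that P_x - kap V_x depends on time only, and the stress-free condition makes
    this function C proportional to V_x(t, L). Inserting P = kap V + C x into
    the third equation leaves dl * (n - n(0)) equal to a function of time times
    x^2. If dl <> 0 the wave is cubic in space; if dl = 0 the second derivative
    of C is constant, and the data of the wave at x = L are polynomials. *)
Lemma sandwich_at_rest (c : coeffs R) (k : R) V v Vx M n P p Px N np (Rv Rn :
  R -> R) :
  let L := len c in let gb := gamma c * beta c * h3 c in
  0 < k ->
  kinematics L V v Vx M n -> kinematics L P p Px N np ->
  (forall t x, 0 <= t -> 0 <= x <= L -> cont_in `[0, L] (v t) x) ->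
  (forall t x, 0 <= t -> 0 <= x <= L -> cont_in `[0, L] (n t) x) ->
  (forall x, 0 <= x <= L -> has_derive `[0, L] Rv x (v 0 x)) ->
  (forall x, 0 <= x <= L -> has_derive `[0, L] Rn x (n 0 x)) ->
  (forall t x, 0 <= t -> 0 <= x <= L ->
    [/\ rho1 c * h1 c * (n t x - n 0 x) = alpha1 c * h1 c * (Vx t x - Vx t 0),
        rho3 c * h3 c * (n t x - n 0 x) =
          alpha3 c * h3 c * (Vx t x - Vx t 0) - gb * (Px t x - Px t 0) &
        mu c * h3 c * (np t x - np 0 x) =
          beta c * h3 c * (Px t x - Px t 0) - gb * (Vx t x - Vx t 0)]) ->
  (forall t, 0 <= t -> alpha1 c * h1 c * Vx t L = - (k * (v t L - v 0 L))) ->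
  (forall t, 0 <= t -> alpha3 c * h3 c * Vx t L - gb * Px t L = 0) ->
  forall t x, 0 <= t -> 0 <= x <= L -> V t x = 0 /\ P t x = 0.
Proof.
move=> L gb k0 kV kP cv cn RvE RnE eqs bc1 bc2.
have L0 : 0 < L by exact: len_gt0.
have LL : 0 <= L <= L by apply/andP; split; lra.
have L00 : 0 <= (0 : R) <= L by apply/andP; split; lra.
have a1 : alpha1 c != 0 by rewrite gt_eqF// alpha1_gt0.
have r1 : rho1 c != 0 by rewrite gt_eqF// rho1_gt0.
have r3 : rho3 c != 0 by rewrite gt_eqF// rho3_gt0.
have h1n : h1 c != 0 by rewrite gt_eqF// h1_gt0.
have h3n : h3 c != 0 by rewrite gt_eqF// h3_gt0.
have gn : gamma c != 0 by rewrite gt_eqF// gamma_gt0.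
have bn : beta c != 0 by rewrite gt_eqF// beta_gt0.
have mn : mu c != 0 by rewrite gt_eqF// mu_gt0.
have Ln : L != 0 by rewrite gt_eqF.
pose r := rho1 c / alpha1 c.
have rne : r != 0 by rewrite mulf_neq0// invr_neq0.
have r0 : 0 < r by rewrite divr_gt0 ?rho1_gt0 ?alpha1_gt0.
pose eta := k / (alpha1 c * h1 c).
have eta0 : 0 < eta by rewrite divr_gt0// mulr_gt0 ?alpha1_gt0 ?h1_gt0.
have bcV t : 0 <= t -> Vx t L = - eta * (v t L - v 0 L).
  move=> t0; have h := bc1 t t0.
  have -> : Vx t L = (alpha1 c * h1 c * Vx t L) / (alpha1 c * h1 c) by field;
    rewrite a1 h1n.
  by rewrite h /eta; field; rewrite a1 h1n.
have eqV : wave_equation L r Vx n.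
  move=> t x t0 xL; have [h _ _] := eqs t x t0 xL.
  have -> : Vx t x - Vx t 0 = (alpha1 c * h1 c * (Vx t x - Vx t 0)) /
    (alpha1 c * h1 c).
    by field; rewrite a1 h1n.
  by rewrite -h /r; field; rewrite a1 h1n.
(* eliminating n - n(0) between the balance laws of the outer layers *)
pose kap := (alpha3 c - rho3 c / r) / (gamma c * beta c).
pose C t := Px t L - kap * Vx t L.
have PxE t x : 0 <= t -> 0 <= x <= L -> Px t x = kap * Vx t x + C t.
  move=> t0 xL.
  have E y : 0 <= y <= L -> Px t y - Px t 0 = kap * (Vx t y - Vx t 0).
    move=> yL; have [_ h _] := eqs t y t0 yL.
    have -> : Px t y - Px t 0 = (alpha3 c * h3 c * (Vx t y - Vx t 0) -
      rho3 c * h3 c * (n t y - n 0 y)) / gb.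
      by rewrite h /gb; field; rewrite gn bn h3n.
    have -> : n t y - n 0 y = (Vx t y - Vx t 0) / r by rewrite eqV//; field.
    by rewrite /kap /gb; field; rewrite gn bn h3n rne.
  have := E x xL; have := E L LL; rewrite /C; lra.
pose nu := r * gamma c * beta c / rho3 c.
have nu0 : 0 < nu.
  by rewrite divr_gt0 ?rho3_gt0// mulr_gt0 ?beta_gt0// mulr_gt0 ?gamma_gt0.
have VxL t : 0 <= t -> Vx t L = nu * C t.
  move=> t0; have h := bc2 t t0; have -> :
    C t = rho3 c / r / (gamma c * beta c) * Vx t L - (alpha3 c * h3 c * Vx t L -
    gb * Px t L) / gb.
    by rewrite /C /kap /gb; field; rewrite gn bn h3n rne.
  rewrite h mul0r subr0 /nu; field.
  by rewrite ?gn ?bn ?rne ?r3.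
case: (kV) (kP) => [Vi Vt Vxx V0 Mt Mx M0] [Pi Pt Pxx P0 Nt Nx N0].
have PE t x : 0 <= t -> 0 <= x <= L -> P t x = kap * V t x + C t * x.
  move=> t0 xL.
  rewrite (@space_integrate L (P t) (Px t) (fun x =>
    kap * V t x + C t * (x ^+ 1 / 1%:R)) _ _ x xL).
  - by rewrite P0// V0//; field.
  - by move=> y yL; exact: Pxx.
  - move=> y yL; have -> : Px t y = kap * Vx t y + C t * y ^+ 0.
      by rewrite PxE// expr0 mulr1.
    by apply: has_deriveD; apply: has_deriveZ; [exact: Vxx|exact: has_deriveX].
pose C1 t := (p t L - kap * v t L) / L.
have C1E t : 0 <= t -> has_derive `[0, +oo[ C t (C1 t).
  move=> t0; have := has_deriveZ L^-1 (has_deriveB (uniform_derive_at Pt LL t0)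
    (has_deriveZ kap (uniform_derive_at Vt LL t0))).
  apply: eq_time_derive => // [s s0|]; last by rewrite /C1; field.
  by rewrite PE//; field.
have pE t x : 0 <= t -> 0 <= x <= L -> p t x = kap * v t x + C1 t * x.
  move=> t0 xL; apply: (has_derive_uniq0 t0 (uniform_derive_at Pt xL t0)).
  have := has_deriveD (has_deriveZ kap (uniform_derive_at Vt xL t0))
    (has_deriveZ x (C1E t t0)).
  apply: eq_time_derive => // [s s0|]; last by ring.
  by rewrite PE//; ring.
have NE t x : 0 <= t -> 0 <= x <= L -> N t x =
  kap * M t x + (C1 t - C1 0) * x ^+ 2 / 2.
  move=> t0 xL.
  rewrite (@space_integrate L (N t) (fun x => p t x - p 0 x) (fun x =>
    kap * M t x + (C1 t - C1 0) * (x ^+ 2 / 2%:R)) _ _ x xL).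
  - by rewrite N0// M0//; field.
  - by move=> y yL; exact: Nx.
  - move=> y yL; have -> : p t y - p 0 y = kap * (v t y - v 0 y) +
    (C1 t - C1 0) * y ^+ 1.
      by rewrite !pE//; ring.
    by apply: has_deriveD; apply: has_deriveZ; [exact: Mx|exact: has_deriveX].
pose C2 t := 2 / L ^+ 2 * (np t L - kap * n t L).
have C2E t : 0 <= t -> has_derive `[0, +oo[ C1 t (C2 t).
  move=> t0; have := has_deriveD (has_derive_cst _ (C1 0) _)
    (has_deriveZ (2 / L ^+ 2) (has_deriveB (uniform_derive_at Nt LL t0)
    (has_deriveZ kap (uniform_derive_at Mt LL t0)))).
  apply: eq_time_derive => // [s s0|]; last by rewrite /C2; field.
  by rewrite NE//; field.
have npE t x : 0 <= t -> 0 <= x <= L -> np t x = kap * n t x +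
  C2 t * x ^+ 2 / 2.
  move=> t0 xL; apply: (has_derive_uniq0 t0 (uniform_derive_at Nt xL t0)).
  have := has_deriveD (has_deriveZ kap (uniform_derive_at Mt xL t0))
    (has_deriveZ (x ^+ 2 / 2) (has_deriveD (C2E t t0)
    (has_derive_cst _ (- C1 0) _))).
  apply: eq_time_derive => // [s s0|]; last by field.
  by rewrite NE//; field.
(* the third equation with p_tt = kap v_tt + c'' x and p_xx = kap v_xx *)
pose dl := kap - (kap - gamma c) * beta c * r / mu c.
have dlE t x : 0 <= t -> 0 <= x <= L ->
    dl * (n t x - n 0 x) = - (C2 t - C2 0) / 2 * x ^+ 2.
  move=> t0 xL; have [_ _ h] := eqs t x t0 xL.
  have h1 : np t x - np 0 x =
    (beta c * (Px t x - Px t 0) - gamma c * beta c * (Vx t x - Vx t 0)) / mu c.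
    transitivity (mu c * h3 c * (np t x - np 0 x) / (mu c * h3 c));
      first by field; rewrite mn h3n.
    by rewrite h /gb; field; rewrite mn h3n.
  move: h1; rewrite !npE// !PxE//.
  have -> : beta c * (kap * Vx t x + C t - (kap * Vx t 0 + C t)) -
    gamma c * beta c * (Vx t x - Vx t 0) =
    (kap - gamma c) * beta c * (Vx t x - Vx t 0) by ring.
  by rewrite eqV// /dl; lra.
have VE0 : forall t x, 0 <= t -> 0 <= x <= L -> V t x = 0.
  have [dl0|dl0] := eqVneq dl 0.
    apply: (@linear_trace_wave_at_rest L r eta nu (C1 0)
      (C2 0) V v Vx M n Rv Rn) => //.
    have C2c t : 0 <= t -> C2 t = C2 0.
      move=> t0; have := dlE t L t0 LL; rewrite dl0 mul0r => /esym/eqP.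
      rewrite mulf_eq0 expf_eq0/= (negbTE Ln) orbF mulf_eq0 invr_eq0 pnatr_eq0
        orbF oppr_eq0 subr_eq0.
      by move/eqP.
    have C1c t : 0 <= t -> C1 t = C1 0 + C2 0 * t.
      move=> t0; rewrite (@time_integrate C1 C2 (fun t =>
        C2 0 * (t ^+ 1 / 1%:R)) C2E _ t t0) /=.
        by field.
      move=> s s0; have -> : C2 s = C2 0 * s ^+ 0 by rewrite C2c// expr0 mulr1.
      by apply: has_deriveZ; exact: has_deriveX.
    have C0 : C 0 = 0.
      have := PE 0 L (lexx 0) LL; rewrite Pi// Vi// mulr0 add0r => /esym/eqP.
      by rewrite mulf_eq0 (negbTE Ln) orbF => /eqP.
    move=> t t0; rewrite VxL//; congr (_ * _).
    rewrite (@time_integrate C C1 (fun t => C1 0 * (t ^+ 1 / 1%:R) +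
      C2 0 * (t ^+ 2 / 2%:R)) C1E _ t t0) /=.
      by rewrite C0; field.
    move=> s s0; have -> : C1 s = C1 0 * s ^+ 0 + C2 0 * s ^+ 1.
      by rewrite (C1c s)// expr0 expr1 mulr1.
    by apply: has_deriveD; apply: has_deriveZ; exact: has_deriveX.
  apply: (@cubic_wave_at_rest L r eta V v Vx M n (fun t =>
    - (C2 t - C2 0) / 2 / dl)) => //.
  move=> t x t0 xL; rewrite mulrAC -dlE//; field.
  exact: dl0.
have Vx0 t x : 0 <= t -> 0 <= x <= L -> Vx t x = 0.
  by move=> t0 xL; have [] := kinematics_at_rest L0 kV VE0 t0 xL.
move=> t x t0 xL; split; first exact: VE0.
rewrite PE// VE0// mulr0 add0r.
have -> : C t = Vx t L / nu by rewrite VxL//; field; rewrite gt_eqF.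
by rewrite Vx0// !mul0r.
Qed.
End SlidingDynamics.

(** * Square integrable functions and their primitives *)

Section SquareIntegrable.
Variable R : realType.
Local Notation mu := (@lebesgue_measure R).
Implicit Types (l x y : R) (f g : R -> R).

Definition sq_integrable l g := measurable_fun `]0, l[ g /\
  (\int[mu]_(x in `]0%R, l[) ((g x) ^+ 2)%:E < +oo)%E.

Definition itg x y g := \int[mu]_(s in `]x, y[) g s.

Definition integrable_on l f := mu.-integrable `]0, l[ (EFin \o f).

Lemma integrable_onD l f g : integrable_on l f -> integrable_on l g ->
  integrable_on l (fun x => f x + g x).
Proof.
move=> hf hg; rewrite /integrable_on (_ : _ \o _ =
  ((EFin \o f) \+ (EFin \o g))%E)//.
exact: integrableD.
Qed.

Lemma integrable_onZ l f (k : R) : integrable_on l f ->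
  integrable_on l (fun x => k * f x).
Proof.
move=> hf; rewrite /integrable_on (_ : _ \o _ = fun x =>
  (k%:E * (EFin \o f) x)%E)//.
exact: integrableZl.
Qed.

Lemma sq_integrableP l g : sq_integrable l g ->
  integrable_on l (fun x => g x ^+ 2).
Proof.
move=> [mg ig]; apply/integrableP; split.
  by apply/measurable_EFinP/measurable_funX.
apply: le_lt_trans ig; apply: ge0_le_integral => //.
- by apply/measurableT_comp => //; apply/measurable_EFinP/measurable_funX.
- by apply/measurable_EFinP/measurable_funX.
- by move=> x _ /=; rewrite lee_fin ger0_norm ?sqr_ge0.
Qed.

Lemma sq_integrableM l f g : sq_integrable l f -> sq_integrable l g ->
  integrable_on l (fun x => f x * g x).
Proof.
move=> sf sg; have := integrable_onD (sq_integrableP sf) (sq_integrableP sg).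
apply: le_integrable => //.
  by apply/measurable_EFinP/measurable_funM; [case: sf|case: sg].
move=> x _ /=; rewrite lee_fin [leRHS]ger0_norm ?addr_ge0 ?sqr_ge0// ler_norml.
apply/andP; split.
- by have := sqr_ge0 (f x + g x); have := sqr_ge0 (f x); have := sqr_ge0 (g x);
  nra.
- by have := sqr_ge0 (f x - g x); have := sqr_ge0 (f x); have := sqr_ge0 (g x);
  nra.
Qed.

Lemma integrable_sq l g : measurable_fun `]0, l[ g ->
  integrable_on l (fun x => g x ^+ 2) -> sq_integrable l g.
Proof. by move=> mg ig; split => //; exact: integrable_lty ig. Qed.

Lemma bounded_sq_integrable l g (K : R) : measurable_fun `]0, l[ g ->
  (forall x, `]0, l[%classic x -> `|g x| <= K) -> sq_integrable l g.
Proof.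
move=> mg gK; apply: integrable_sq => //.
have muf : (mu `]0%R, l[%classic < +oo)%E.
  by rewrite lebesgue_measure_itv/=; case: ifPn => // _; rewrite -EFinB ltry.
apply: measurable_bounded_integrable => //; first exact: measurable_funX.
exists (K ^+ 2); split; first exact: num_real.
  move=> M /ltW KM x /gK h /=; apply: le_trans KM;
    rewrite normrX lerXn2r ?nnegrE//.
  exact: le_trans h.
Qed.

Lemma sq_integrable_cst l (k : R) : sq_integrable l (fun=> k).
Proof. by apply: (@bounded_sq_integrable _ _ `|k|) => // x _. Qed.

Lemma sq_integrable_integrable l g : sq_integrable l g ->
  integrable_on l g.
Proof.
move=> /sq_integrableM /(_ (sq_integrable_cst l 1)).
by congr integrable_on; apply/funext => x /=; rewrite mulr1.
Qed.

Lemma sq_integrableZ l g (k : R) : sq_integrable l g ->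
  sq_integrable l (fun x => k * g x).
Proof.
move=> sg; apply: integrable_sq; first by apply: measurable_funM => //;
  case: sg.
have := integrable_onZ (k ^+ 2) (sq_integrableP sg).
by congr integrable_on; apply/funext => x /=; rewrite exprMn.
Qed.

Lemma sq_integrableD l f g : sq_integrable l f -> sq_integrable l g ->
  sq_integrable l (fun x => f x + g x).
Proof.
move=> sf sg; apply: integrable_sq; first by apply: measurable_funD;
  [case: sf|case: sg].
have := integrable_onD (integrable_onD (sq_integrableP sf) (sq_integrableP sg))
  (integrable_onZ 2 (sq_integrableM sf sg)).
by congr integrable_on; apply/funext => x /=; ring.
Qed.

Lemma sq_integrable_sub l x y g : 0 <= x -> y <= l -> sq_integrable l g ->
  mu.-integrable `]x, y[ (EFin \o g).
Proof.
move=> x0 yl /sq_integrable_integrable; apply: integrableS => //.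
by apply: subset_itv; rewrite bnd_simp.
Qed.

Lemma itgD l x y f g : 0 <= x -> y <= l -> sq_integrable l f ->
  sq_integrable l g ->
  itg x y (fun s => f s + g s) = itg x y f + itg x y g.
Proof.
by move=> x0 yl sf sg; apply: RintegralD => //;
  exact: sq_integrable_sub sf || exact: sq_integrable_sub sg.
Qed.

Lemma itgZ l x y g (k : R) : 0 <= x -> y <= l -> sq_integrable l g ->
  itg x y (fun s => k * g s) = k * itg x y g.
Proof. by move=> x0 yl sg; apply: RintegralZl => //;
  exact: sq_integrable_sub sg. Qed.

Lemma itg_cst x y (k : R) : x <= y -> itg x y (fun=> k) = k * (y - x).
Proof.
move=> xy; rewrite /itg Rintegral_cst//= lebesgue_measure_itv/= lte_fin.
by case: ltgtP xy => // [->] _; rewrite subrr.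
Qed.

Lemma itg_split l x y g : 0 <= x -> x <= y -> y <= l -> sq_integrable l g ->
  itg 0 y g - itg 0 x g = itg x y g.
Proof.
move=> x0; rewrite le_eqVlt => /predU1P[<-|xy] yl sg.
  by rewrite subrr /itg set_itv_ge ?bnd_simp ?ltxx// Rintegral_set0.
have i0y := sq_integrable_sub (lexx 0) yl sg.
have i0x := sq_integrable_sub (lexx 0) (le_trans (ltW xy) yl) sg.
rewrite /itg (Rintegral_itv_bndo_bndc i0x).
by apply: Rintegral_itvB; rewrite ?bnd_simp.
Qed.

Lemma itg_sq_sub x y l g : 0 <= x -> x <= y -> y <= l -> sq_integrable l g ->
  itg x y (fun s => g s ^+ 2) <= itg 0 l (fun s => g s ^+ 2).
Proof.
move=> x0 xy yl /sq_integrableP ig.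
rewrite /itg /Rintegral fine_le//.
- apply: integrable_fin_num => //; apply: integrableS ig => //.
  by apply: subset_itv; rewrite bnd_simp.
- exact: integrable_fin_num.
apply: ge0_subset_integral => //.
- by apply/measurable_EFinP; case/integrableP : ig => /measurable_EFinP.
- by move=> s _; rewrite lee_fin sqr_ge0.
- by apply: subset_itv; rewrite bnd_simp.
Qed.

(** Cauchy-Schwarz against the constant 1, from the nonnegativity of the
    integral of (g - m)^2, where m is the mean of [g] over ]x, y[. *)
Lemma itg_sqr_le x y l g : 0 <= x -> x <= y -> y <= l -> sq_integrable l g ->
  itg x y g ^+ 2 <= (y - x) * itg 0 l (fun s => g s ^+ 2).
Proof.
move=> x0 xy yl sg.
apply: le_trans (ler_wpM2l _ (itg_sq_sub x0 xy yl sg));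
  last by rewrite subr_ge0.
move: xy; rewrite le_eqVlt => /predU1P[<-|xy].
  have -> : itg x x g = 0.
    by rewrite /itg set_itv_ge ?bnd_simp ?ltxx// Rintegral_set0.
  by rewrite subrr mul0r expr0n.
set d := y - x; have d0 : 0 < d by rewrite subr_gt0.
set m := itg x y g / d.
have sub : `]x, y[ `<=` `]0, l[ by apply: subset_itv; rewrite bnd_simp.
have i1 : mu.-integrable `]x, y[ (EFin \o (fun s => g s ^+ 2)).
  by apply: integrableS (sq_integrableP sg).
have i2 : mu.-integrable `]x, y[ (EFin \o (fun s => - 2 * m * g s)).
  by apply: integrableS (integrable_onZ (- 2 * m)
    (sq_integrable_integrable sg)).
have i3 : mu.-integrable `]x, y[ (EFin \o (fun=> m ^+ 2)).
  by apply: integrableS (sq_integrable_integrable (sq_integrable_cst l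
    (m ^+ 2))).
have i23 : mu.-integrable `]x, y[ (EFin \o (fun s => - 2 * m * g s + m ^+ 2)).
  have := integrable_onD (integrable_onZ (- 2 * m)
    (sq_integrable_integrable sg)) (sq_integrable_integrable
    (sq_integrable_cst l (m ^+ 2))).
  by apply: integrableS.
have : 0 <= itg x y (fun s => (g s - m) ^+ 2).
  by apply: Rintegral_ge0 => s _; exact: sqr_ge0.
have -> : itg x y (fun s => (g s - m) ^+ 2) = itg x y (fun s =>
  g s ^+ 2 + (- 2 * m * g s + m ^+ 2)).
  by congr itg; apply/funext => s; ring.
have -> : itg x y (fun s => g s ^+ 2 + (- 2 * m * g s + m ^+ 2)) =
    itg x y (fun s => g s ^+ 2) + (- 2 * m * itg x y g + m ^+ 2 * d).
  rewrite /itg RintegralD// RintegralD// RintegralZl//;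
    last exact: sq_integrable_sub sg.
  by rewrite -(itg_cst (m ^+ 2) (ltW xy)).
move=> /(ler_wpM2l (ltW d0)); rewrite mulr0.
set J := itg x y (fun=> _).
have -> : d * (J + (- 2 * m * itg x y g + m ^+ 2 * d)) = d * J - itg x y g ^+ 2.
  by rewrite /m; field; rewrite gt_eqF.
by rewrite subr_ge0.
Qed.

Lemma itg0 (g : R -> R) : itg 0 0 g = 0.
Proof. by rewrite /itg set_itv_ge ?bnd_simp ?ltxx// Rintegral_set0. Qed.

Lemma itg_cont l g x : sq_integrable l g -> 0 <= x <= l ->
  cont_in `[0, l] (fun y => itg 0 y g) x.
Proof.
move=> sg /andP[x0 xl] e e0; set K := itg 0 l (fun s => g s ^+ 2).
have K0 : 0 <= K by apply: Rintegral_ge0 => s _; exact: sqr_ge0.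
have e1 : 0 < e ^+ 2 / (1 + K) by rewrite divr_gt0 ?exprn_gt0// ltr_pwDl.
near=> y => /=; rewrite in_itv/= => /andP[y0 yl].
have yx : `|y - x| < e ^+ 2 / (1 + K) by near: y; exact: near_dist.
rewrite -(ler_pXn2r (n := 2)) ?nnegrE ?(ltW e0)// real_normK ?num_real//.
apply: (@le_trans _ _ (`|y - x| * K)).
  have [xy|yx'] := leP x y.
    by rewrite (itg_split x0 xy yl sg) ger0_norm ?subr_ge0// itg_sqr_le.
  rewrite -sqrrN opprB (itg_split y0 (ltW yx') xl sg) distrC ger0_norm ?subr_ge0
    ?(ltW yx')//.
  by rewrite itg_sqr_le// ltW.
apply: (@le_trans _ _ (e ^+ 2 / (1 + K) * K)); first by rewrite ler_wpM2r// ltW.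
rewrite mulrAC ler_pdivrMr ?ltr_pwDl//.
by rewrite ler_wpM2l ?sqr_ge0// lerDr.
Unshelve. all: by end_near. Qed.

Lemma itg_derive l g x : sq_integrable l g -> 0 <= x <= l ->
  cont_in `[0, l] g x ->
  has_derive `[0, l] (fun y => itg 0 y g) x (g x).
Proof.
move=> sg /andP[x0 xl] cg e e0.
have H a b : 0 <= a -> a <= b -> b <= l -> (forall s, `]a, b[%classic s ->
  `|g s - g x| <= e) ->
    `|itg 0 b g - itg 0 a g - g x * (b - a)| <= e * (b - a).
  move=> a0 ab bl ge.
  rewrite (itg_split a0 ab bl sg) -(itg_cst (g x) ab) -(itg_cst e ab).
  have sgx : sq_integrable l (fun s => g s - g x) by apply: sq_integrableD =>
    //; exact: sq_integrable_cst.
  have ig := sq_integrable_sub a0 bl sgx.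
  rewrite /itg -RintegralB//;
    [|exact: sq_integrable_sub sg|exact: sq_integrable_sub
    (sq_integrable_cst l _)].
  apply: le_trans (le_normr_Rintegral _ _) _ => //.
  apply: le_Rintegral => //;
    last exact: sq_integrable_sub (sq_integrable_cst l _).
  by move/integrable_norm: ig; apply: eq_integrable.
have /nbhs_ballP[r /= r0 Hr] := cg e e0.
near=> y => /=; rewrite in_itv/= => /andP[y0 yl].
have yx : `|y - x| < r by near: y; exact: near_dist.
have Hs s : `[0, l]%classic s -> `|s - x| < r -> `|g s - g x| <= e.
  by move=> Ls sx; apply: Hr => //; rewrite /ball/= distrC.
have [xy|yx'] := leP x y.
  rewrite [X in e * X]ger0_norm ?subr_ge0//; apply: (H x y) => // s /=;
    rewrite in_itv/= => /andP[xs sy].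
  apply: Hs; first by rewrite /= in_itv/=; apply/andP; split; lra.
  by apply: le_lt_trans yx; rewrite !ger0_norm; lra.
have -> : itg 0 y g - itg 0 x g - g x * (y - x) =
  - (itg 0 x g - itg 0 y g - g x * (x - y)) by ring.
rewrite normrN [in leRHS]distrC [X in e * X]ger0_norm ?subr_ge0 ?(ltW yx')//;
  apply: (H y x) => //; first exact: ltW.
move=> s /=; rewrite in_itv/= => /andP[xs sy].
apply: Hs; first by rewrite /= in_itv/=; apply/andP; split; lra.
by apply: le_lt_trans yx; rewrite !ler0_norm; lra.
Unshelve. all: by end_near. Qed.

Lemma ae_mono (P Q : R -> Prop) : (forall x, P x -> Q x) ->
  (\forall x \ae mu, P x) -> \forall x \ae mu, Q x.
Proof. exact: (@filterS _ _ (ae_filter_ringOfSetsType mu)). Qed.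

Lemma ae_and (P Q : R -> Prop) : (\forall x \ae mu, P x) ->
  (\forall x \ae mu, Q x) -> \forall x \ae mu, P x /\ Q x.
Proof. exact: (@filterI _ _ (ae_filter_ringOfSetsType mu)). Qed.

(** By Lebesgue's differentiation theorem the primitive of [g] has
    derivative [g] almost everywhere. *)
Lemma itg_eq0_ae l g : 0 < l -> sq_integrable l g ->
  (forall x, 0 <= x <= l -> itg 0 x g = 0) ->
  \forall x \ae mu, x \in `]0, l[ -> g x = 0.
Proof.
move=> l0 sg g0; pose f := g \_ `]0, l[.
have ig := sq_integrable_integrable sg.
(* [f] is 0 outside ]0, l[, so its primitive vanishes on the whole line *)
have iff : mu.-integrable setT (EFin \o f).
  by rewrite /f -restrict_EFin; apply/integrable_restrict => //; rewrite setTI.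
have F0 : (fun x => \int[mu]_(t in [set` `]0, x]]) f t) = cst 0.
  apply/funext => x /=.
  have -> : \int[mu]_(t in [set` `]0, x]]) f t = \int[mu]_(t in `]0, x] `&` `]0,
    l[) g t.
    by rewrite Rintegral_mkcondr.
  have [x0|x0] := leP x 0.
    by rewrite set_itv_ge ?bnd_simp -?leNgt// set0I Rintegral_set0.
  have [xl|xl] := leP l x.
    rewrite setIidr; last by apply: subset_itv; rewrite bnd_simp.
    by apply: g0; rewrite lexx ltW.
  rewrite setIidl; last by apply: subset_itv; rewrite bnd_simp.
  rewrite -Rintegral_itv_bndo_bndc; last exact: sq_integrable_sub (lexx 0)
    (ltW xl) sg.
  by apply: g0; rewrite !ltW.
have locf : locally_integrable [set: R] f by exact: integrable_locally.
have := @FTC1 R f (BRight 0) _ locf; rewrite F0.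
have iffy y : mu.-integrable `]0, y] (EFin \o f) by exact: integrableS iff.
move=> /(_ iffy); apply: ae_mono => x Hx.
rewrite in_itv/= => /andP[x0 xl].
have /Hx[_] : (BRight 0 < BRight x)%O by rewrite bnd_simp.
by rewrite derive1_cst /f patchE mem_set ?in_itv//= ?in_itv/= ?x0.
Qed.

Lemma ae_eq_itg l f g x y : 0 <= x -> y <= l -> sq_integrable l f ->
  sq_integrable l g ->
  (\forall x \ae mu, x \in `]0, l[ -> f x = g x) -> itg x y f = itg x y g.
Proof.
move=> x0 yl sf sg fg; rewrite /itg /Rintegral; congr fine.
have sub : `]x, y[ `<=` `]0, l[ by apply: subset_itv; rewrite bnd_simp.
apply: ae_eq_integral => //.
- by case/integrableP: (sq_integrable_sub x0 yl sf).
- by case/integrableP: (sq_integrable_sub x0 yl sg).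
- by move: fg; apply: ae_mono => s H /sub /= Hs; rewrite /= H.
Qed.

End SquareIntegrable.

(** * Real and imaginary parts of weak derivatives *)

Local Open Scope complex_scope.

Section RealParts.
Variable R : realType.
Implicit Types (l x : R) (f g : cfun R) (b : bool).

(** The system has real coefficients, so the real parts (for [true]) and the
    imaginary parts (for [false]) of a solution evolve independently. *)
Definition part b (z : R[i]) : R := if b then complex.Re z else complex.Im z.

Lemma partD b (y z : R[i]) : part b (y + z) = part b y + part b z.
Proof. by case: b y z => [] [? ?] [? ?]. Qed.

Lemma partN b (z : R[i]) : part b (- z) = - part b z.
Proof. by case: b z => [] [? ?]. Qed.

Lemma partB b (y z : R[i]) : part b (y - z) = part b y - part b z.
Proof. by rewrite partD partN. Qed.

Lemma partZ b (k : R) (z : R[i]) : part b (k%:C * z) = k * part b z.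
Proof. by case: b z => [] [? ?] /=; rewrite mul0r ?subr0 ?addr0. Qed.

Lemma part0 b : part b 0 = 0.
Proof. by case: b. Qed.

Definition partE := (partB, partN, partD, partZ, part0).

Lemma sqr_normc_part (z : R[i]) : normc z ^+ 2 = part true z ^+ 2 +
  part false z ^+ 2.
Proof. by case: z => a b /=; rewrite sqr_sqrtr// addr_ge0 ?sqr_ge0. Qed.

Lemma part_inj (y z : R[i]) : (forall b, part b y = part b z) -> y = z.
Proof.
by move=> h; case: y z h => [y1 y2] [z1 z2] h; move: (h true) (h false) => /= ->
  ->.
Qed.

Lemma part_cintegral b x (y : R) f : part b (cintegral x y f) =
  itg x y (fun s => part b (f s)).
Proof. by case: b. Qed.

Lemma L2_part l f : L2 l f <-> forall b, sq_integrable l (fun x =>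
  part b (f x)).
Proof.
split=> [[mr mi fi] b|h].
- split; first by case: b.
  apply: le_lt_trans fi; apply: ge0_le_integral => //.
  + by move=> x _; rewrite lee_fin sqr_ge0.
  + by case: b; apply/measurable_EFinP/measurable_funX.
  + apply/measurable_EFinP.
    have -> : (fun x => normc (f x) ^+ 2) =
      (fun x => part true (f x) ^+ 2 + part false (f x) ^+ 2).
      by apply/funext => x; rewrite sqr_normc_part.
    by apply: measurable_funD; apply: measurable_funX.
  + move=> x _; rewrite lee_fin sqr_normc_part.
    by case: b; [rewrite lerDl|rewrite lerDr]; rewrite sqr_ge0.
- have [mr _] := h true; have [mi _] := h false; split => //.
  have := integrable_lty _ (integrable_onD (sq_integrableP (h true))
    (sq_integrableP (h false))).
  move=> /(_ (measurable_itv _)); congr (_ < _)%E.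
  by apply: eq_integral => x _ /=; rewrite sqr_normc_part.
Qed.

Definition real_wderiv l (f g : R -> R) := sq_integrable l g /\
  forall x, 0 <= x <= l -> f x = f 0 + itg 0 x g.

Lemma wderiv_part l f g : wderiv l f g <->
  forall b, real_wderiv l (fun x => part b (f x)) (fun x => part b (g x)).
Proof.
split=> [[/L2_part g2 fg] b|h].
  split; first exact: g2.
  by move=> x xl; rewrite fg ?in_itv// partD part_cintegral.
split; first by apply/L2_part => b; have [] := h b.
move=> x; rewrite in_itv/= => xl; apply: part_inj => b.
by rewrite partD part_cintegral; have [_ ->] := h b.
Qed.

Lemma real_wderiv_cont l (f g : R -> R) x : real_wderiv l f g -> 0 <= x <= l ->
  cont_in `[0, l] f x.
Proof.
move=> [sg fg] xl e e0; apply: filterS (itg_cont sg xl e0) => y H Ly.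
have yl : 0 <= y <= l by move: Ly; rewrite /= in_itv.
rewrite (fg y yl) (fg x xl) opprD addrACA subrr add0r; exact: H.
Qed.

(** The weak derivative [g] is itself continuous, so the fundamental theorem of
    calculus makes it a classical one, endpoints included. *)
Lemma real_wderiv_derive l (f g k : R -> R) x : real_wderiv l f g ->
  real_wderiv l g k ->
  0 <= x <= l -> has_derive `[0, l] f x (g x).
Proof.
move=> [sg fg] gk xl.
have := has_deriveD (has_derive_cst `[0, l] (f 0) x)
  (itg_derive sg xl (real_wderiv_cont gk xl)).
rewrite add0r; apply: eq_has_derive; first by rewrite /= in_itv.
by move=> y; rewrite inE/= in_itv/= => yl; rewrite -fg.
Qed.

Lemma real_wderivD l (f g f' g' : R -> R) : real_wderiv l f g ->
  real_wderiv l f' g' ->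
  real_wderiv l (fun x => f x + f' x) (fun x => g x + g' x).
Proof.
move=> [sg fg] [sg' fg']; split; first exact: sq_integrableD.
move=> x /andP[x0 xl]; rewrite (itgD (lexx 0) xl)// fg ?x0// fg' ?x0//.
by ring.
Qed.

Lemma real_wderivZ l (f g : R -> R) (k : R) : real_wderiv l f g ->
  real_wderiv l (fun x => k * f x) (fun x => k * g x).
Proof.
move=> [sg fg]; split; first exact: sq_integrableZ.
by move=> x /andP[x0 xl]; rewrite (itgZ _ (lexx 0) xl)// fg ?x0// mulrDr.
Qed.

Lemma real_wderiv0 l (f g : R -> R) : 0 < l -> real_wderiv l f g ->
  (forall x, 0 <= x <= l -> f x = 0) -> forall x, 0 <= x <= l -> itg 0 x g = 0.
Proof.
move=> l0 [_ fg] f0 x xl; have := fg x xl; rewrite !f0//;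
  last by rewrite lexx ltW.
by rewrite add0r.
Qed.

Lemma real_wderiv_derive0 l (f g k : R -> R) : 0 < l -> real_wderiv l f g ->
  real_wderiv l g k ->
  (forall x, 0 <= x <= l -> f x = 0) -> forall x, 0 <= x <= l -> g x = 0.
Proof.
move=> l0 fg gk f0 x xl.
apply: (has_derive_uniq l0 (@subset_refl _ _) xl (real_wderiv_derive fg gk xl)).
apply: eq_has_derive (has_derive_cst `[0, l] 0 x); first by rewrite /= in_itv.
by move=> y; rewrite inE/= in_itv/= => yl; rewrite f0.
Qed.

(** A primitive of a square integrable function is continuous on [0, l], hence
    measurable, and it is bounded by [itg_sqr_le]. *)
Lemma real_wderiv_sq_integrable l (f g : R -> R) : 0 < l -> real_wderiv l f g ->
  sq_integrable l f.
Proof.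
move=> l0 [sg fg]; pose K := itg 0 l (fun s => g s ^+ 2).
have K0 : 0 <= K by apply: Rintegral_ge0 => s _; exact: sqr_ge0.
have bd : forall x, `]0, l[%classic x -> `|f x| <= `|f 0| + (1 + l * K).
  move=> x /=; rewrite in_itv/= => /andP[x0 xl].
  rewrite fg ?(ltW x0) ?(ltW xl)// (le_trans (ler_normD _ _))// lerD2l.
  have h := itg_sqr_le (lexx 0) (ltW x0) (ltW xl) sg; rewrite subr0 -/K in h.
  have h2 : x * K <= l * K by rewrite ler_wpM2r// ltW.
  have lK : 0 <= l * K by rewrite mulr_ge0// ltW.
  have lK1 : 0 <= 1 + l * K by rewrite addr_ge0.
  rewrite -(ler_pXn2r (n := 2)) ?nnegrE// real_normK ?num_real//; move: lK.
  by move: h h2; set I := _ ^+ 2; set J := l * K; nra.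
apply: (bounded_sq_integrable _ bd).
apply: (@measurable_funS _ _ _ _ `[0, l]) => //; first exact: subset_itv_oo_cc.
apply: subspace_continuous_measurable_fun => //.
apply/subspace_continuousP => x; rewrite /= in_itv/= => xl.
apply/cvgrPdist_le => e e0; rewrite near_withinE.
apply: filterS (real_wderiv_cont (conj sg fg) xl e0) => y H Ly.
by rewrite distrC; exact: H.
Qed.
End RealParts.

(** * What the energy norm controls *)

Section Energy.
Variables (R : realType) (c : coeffs R).
Local Notation l := (len c).
Implicit Types (z : state R) (b : bool) (x : R).

(** With k = 1 / (s - t), f and g a component of U at times s and t, and h that
    of u at time t, this is the error of the difference quotient whose energy
    norm tends to 0. *)
Definition comb (k : R) (f g h : cfun R) : cfun R :=
  fun x => k%:C * (f x - g x) - h x.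

Lemma wderiv_comb k (f g h f' g' h' : cfun R) : wderiv l f f' ->
  wderiv l g g' -> wderiv l h h' ->
  wderiv l (comb k f g h) (comb k f' g' h').
Proof.
move=> /wderiv_part hf /wderiv_part hg /wderiv_part hh; apply/wderiv_part => b.
have := real_wderivD
  (real_wderivZ k (real_wderivD (hf b) (real_wderivZ (-1) (hg b))))
  (real_wderivZ (-1) (hh b)).
by congr real_wderiv; apply/funext => x; rewrite /comb !partE; ring.
Qed.

Lemma L2_comb k (f g h : cfun R) : L2 l f -> L2 l g -> L2 l h ->
  L2 l (comb k f g h).
Proof.
move=> /L2_part hf /L2_part hg /L2_part hh; apply/L2_part => b.
have := sq_integrableD (sq_integrableZ k (sq_integrableD (hf b)
  (sq_integrableZ (-1) (hg b)))) (sq_integrableZ (-1) (hh b)).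
by congr sq_integrable; apply/funext => x; rewrite /comb !partE; ring.
Qed.

Lemma comb0 k (f g h : cfun R) : f 0 = 0 -> g 0 = 0 -> h 0 = 0 ->
  comb k f g h 0 = 0.
Proof. by rewrite /comb => -> -> ->; rewrite !subr0 mulr0. Qed.

Lemma H1L_comb k (f g h : cfun R) : H1L l f -> H1L l g -> H1L l h ->
  H1L l (comb k f g h).
Proof.
move=> [[f' ff] f0] [[g' gg] g0] [[h' hh] h0]; split; last exact: comb0.
by exists (comb k f' g' h'); exact: wderiv_comb.
Qed.

Lemma H2L_comb k (f g h : cfun R) : H2L l f -> H2L l g -> H2L l h ->
  H2L l (comb k f g h).
Proof.
move=> [f' [f'' [ff ff' f0 f0']]] [g' [g'' [gg gg' g0 g0']]]
  [h' [h'' [hh hh' h0 h0']]].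
exists (comb k f' g' h'), (comb k f'' g'' h''); split; try exact: comb0.
all: exact: wderiv_comb.
Qed.

Lemma in_energy_space_comb (k : R) (u v z : state R) :
  in_energy_space c u -> in_energy_space c v -> in_energy_space c z ->
  in_energy_space c (k%:C *: (u - v) - z).
Proof.
move=> [[u1 u2 u3 u4] [u5 u6 u7 u8]] [[w1 w2 w3 w4] [w5 w6 w7 w8]]
  [[z1 z2 z3 z4] [z5 z6 z7 z8]].
split; split.
- exact: H1L_comb u1 w1 z1.
- exact: H1L_comb u2 w2 z2.
- exact: H1L_comb u3 w3 z3.
- exact: H2L_comb u4 w4 z4.
- exact: L2_comb u5 w5 z5.
- exact: L2_comb u6 w6 z6.
- exact: L2_comb u7 w7 z7.
- exact: H1L_comb u8 w8 z8.
Qed.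

Lemma dxP (f : cfun R) : H1 l f -> wderiv l f (dx l f).
Proof. by move=> [g fg]; apply: (@xgetPex _ 0 [set g | wderiv l f g]);
  exists g. Qed.

Lemma H2L_H1 (f : cfun R) : H2L l f -> H1 l f.
Proof. by move=> [g [? [fg _ _ _]]]; exists g. Qed.

Lemma dxxP (f : cfun R) : H2L l f -> exists2 g, wderiv l f g &
  wderiv l g (dxx l f).
Proof.
move=> [g [k [fg gk _ _]]].
by apply: (@xgetPex _ 0 [set k | exists2 g, wderiv l f g & wderiv l g k]);
  exists k, g.
Qed.

(** The energy density of one real part of the state. *)
Definition quad (y1 y3 yp yw ywx d1 d3 dp ww ph : R) : R :=
  rho1 c * h1 c * y1 ^+ 2 + rho3 c * h3 c * y3 ^+ 2 + mu c * h3 c * yp ^+ 2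
  + mass c * yw ^+ 2 + K1 c * ywx ^+ 2 + alpha1 c * h1 c * d1 ^+ 2
  + alpha3 c * h3 c * d3 ^+ 2 + K2 c * ww ^+ 2
  - 2 * (gamma c * beta c * h3 c) * (d3 * dp) + beta c * h3 c * dp ^+ 2
  + G2 c * h2 c * ph ^+ 2.

Definition density z b x : R :=
  let d := dx l in
  quad (part b (v1_t z x)) (part b (v3_t z x)) (part b (p_t z x))
    (part b (w_t z x)) (part b (d (w_t z) x)) (part b (d (v1 z) x))
    (part b (d (v3 z) x)) (part b (d (p z) x)) (part b (dxx l (w z) x))
    (part b (phi2 c (v1 z) (v3 z) (d (w z)) x)).

Lemma energy2_density z :
  energy2 c z = itg 0 l (fun x => density z true x + density z false x).
Proof.
rewrite /energy2 /itg; apply: eq_Rintegral => x _.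
rewrite !sqr_normc_part.
have -> (a b : R[i]) : complex.Re (a * b^* + b * a^*) =
  2 * (part true a * part true b + part false a * part false b).
  by case: a b => [a1 a2] [b1 b2] /=; ring.
by rewrite /density /quad /=; ring.
Qed.

Definition coeff_gt0 := (rho1_gt0 c, rho2_gt0 c, rho3_gt0 c, h1_gt0 c, h2_gt0 c,
  h3_gt0 c, len_gt0 c, alpha1_gt0 c, alpha31_gt0 c, gamma_gt0 c, beta_gt0 c,
  mu_gt0 c, G2_gt0 c).

Lemma HH_gt0 : 0 < HH c.
Proof. by rewrite divr_gt0// !addr_gt0 ?mulr_gt0 ?coeff_gt0. Qed.
Lemma alpha3_gt0 : 0 < alpha3 c.
Proof. by rewrite addr_gt0 ?mulr_gt0 ?exprn_gt0 ?coeff_gt0. Qed.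
Lemma mass_gt0 : 0 < mass c.
Proof. by rewrite !addr_gt0 ?mulr_gt0 ?coeff_gt0. Qed.
Lemma K1_gt0 : 0 < K1 c.
Proof. by rewrite divr_gt0// !addr_gt0 ?mulr_gt0 ?exprn_gt0 ?coeff_gt0. Qed.
Lemma K2_gt0 : 0 < K2 c.
Proof. by rewrite divr_gt0// !addr_gt0 ?mulr_gt0 ?exprn_gt0 ?alpha3_gt0
  ?coeff_gt0. Qed.

(** The minimum over d3 of h3 (alpha31 d3^2 + beta (gamma d3 - dp)^2) is this
    constant times dp^2. *)
Definition coupled_stiffness :=
  h3 c * (alpha31 c * beta c / (alpha31 c + beta c * gamma c ^+ 2)).

Lemma coupled_stiffness_gt0 : 0 < coupled_stiffness.
Proof.
have s : 0 < alpha31 c + beta c * gamma c ^+ 2.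
  by rewrite addr_gt0 ?mulr_gt0 ?exprn_gt0 ?coeff_gt0.
exact: mulr_gt0 (h3_gt0 c) (divr_gt0 (mulr_gt0 (alpha31_gt0 c) (beta_gt0 c)) s).
Qed.

(** As alpha3 = alpha31 + gamma^2 beta, the coupled terms in d3 and dp are
    h3 (alpha31 d3^2 + beta (gamma d3 - dp)^2); completing the square in d3
    leaves the bound in dp. *)
Lemma quad_ge (y1 y3 yp yw ywx d1 d3 dp ww ph : R) :
  let q := quad y1 y3 yp yw ywx d1 d3 dp ww ph in
  [/\ rho1 c * h1 c * y1 ^+ 2 <= q, rho3 c * h3 c * y3 ^+ 2 <= q,
      mu c * h3 c * yp ^+ 2 <= q & K1 c * ywx ^+ 2 <= q] /\
  [/\ alpha1 c * h1 c * d1 ^+ 2 <= q, alpha31 c * h3 c * d3 ^+ 2 <= q,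
      coupled_stiffness * dp ^+ 2 <= q & G2 c * h2 c * ph ^+ 2 <= q].
Proof.
move=> q.
have t (a y : R) : 0 < a -> 0 <= a * y ^+ 2.
  by move=> a0; rewrite mulr_ge0 ?sqr_ge0// ltW.
have s : 0 < alpha31 c + beta c * gamma c ^+ 2 by rewrite addr_gt0 ?mulr_gt0
  ?exprn_gt0 ?coeff_gt0.
have qE : q = rho1 c * h1 c * y1 ^+ 2 + rho3 c * h3 c * y3 ^+ 2 +
  mu c * h3 c * yp ^+ 2
  + mass c * yw ^+ 2 + K1 c * ywx ^+ 2 + alpha1 c * h1 c * d1 ^+ 2 +
    K2 c * ww ^+ 2
  + G2 c * h2 c * ph ^+ 2 + (alpha31 c * h3 c * d3 ^+ 2 +
    beta c * h3 c * (gamma c * d3 - dp) ^+ 2).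
  by rewrite /q /quad /alpha3; ring.
have e : alpha31 c * h3 c * d3 ^+ 2 + beta c * h3 c * (gamma c * d3 - dp) ^+ 2 =
  coupled_stiffness * dp ^+ 2 + h3 c / (alpha31 c + beta c * gamma c ^+ 2) *
    ((alpha31 c + beta c * gamma c ^+ 2) * d3 - beta c * gamma c * dp) ^+ 2.
  by rewrite /coupled_stiffness; field; rewrite gt_eqF.
have t1 := t _ y1 (mulr_gt0 (rho1_gt0 c) (h1_gt0 c)).
have t2 := t _ y3 (mulr_gt0 (rho3_gt0 c) (h3_gt0 c)).
have t3 := t _ yp (mulr_gt0 (mu_gt0 c) (h3_gt0 c)).
have t4 := t _ yw mass_gt0.
have t5 := t _ ywx K1_gt0.
have t6 := t _ d1 (mulr_gt0 (alpha1_gt0 c) (h1_gt0 c)).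
have t7 := t _ ww K2_gt0.
have t8 := t _ ph (mulr_gt0 (G2_gt0 c) (h2_gt0 c)).
have t9 := t _ d3 (mulr_gt0 (alpha31_gt0 c) (h3_gt0 c)).
have t10 := t _ (gamma c * d3 - dp) (mulr_gt0 (beta_gt0 c) (h3_gt0 c)).
have t11 := t _ dp coupled_stiffness_gt0.
have t12 := t _ ((alpha31 c + beta c * gamma c ^+ 2) * d3 -
  beta c * gamma c * dp) (divr_gt0 (h3_gt0 c) s).
by move: qE; rewrite -/q => ->; (split; split); last 2 [rewrite e]; lra.
Qed.

Lemma part_phi2 (f g h : cfun R) b x : part b (phi2 c f g h x) =
  (h2 c)^-1 * (- part b (f x) + part b (g x) + HH c * part b (h x)).
Proof. by rewrite /phi2 !partE. Qed.

Record real_data z b : Prop := RealData {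
  data_v1 : real_wderiv l (fun x => part b (v1 z x)) (fun x =>
    part b (dx l (v1 z) x)) ;
  data_v3 : real_wderiv l (fun x => part b (v3 z x)) (fun x =>
    part b (dx l (v3 z) x)) ;
  data_p : real_wderiv l (fun x => part b (p z x)) (fun x =>
    part b (dx l (p z) x)) ;
  data_w : real_wderiv l (fun x => part b (w z x)) (fun x =>
    part b (dx l (w z) x)) ;
  data_wt : real_wderiv l (fun x => part b (w_t z x)) (fun x =>
    part b (dx l (w_t z) x)) ;
  data_wxx : sq_integrable l (fun x => part b (dxx l (w z) x)) ;
  data_v1t : sq_integrable l (fun x => part b (v1_t z x)) ;
  data_v3t : sq_integrable l (fun x => part b (v3_t z x)) ;
  data_pt : sq_integrable l (fun x => part b (p_t z x)) ;
  data_phi : sq_integrable l (fun x =>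
    part b (phi2 c (v1 z) (v3 z) (dx l (w z)) x)) ;
  data_0 : [/\ v1 z 0 = 0, v3 z 0 = 0, p z 0 = 0, w z 0 = 0 & w_t z 0 = 0] }.

Lemma in_energy_space_data z b : in_energy_space c z -> real_data z b.
Proof.
move=> [[[e1 z1] [e2 z2] [e3 z3] e4] [e5 e6 e7 [e8 z8]]].
have w0 : w z 0 = 0 by case: e4 => [? [? []]].
have d1 := (wderiv_part _ _ _).1 (dxP e1) b.
have d3 := (wderiv_part _ _ _).1 (dxP e2) b.
have dw := (wderiv_part _ _ _).1 (dxP (H2L_H1 e4)) b.
split => //.
- exact: (wderiv_part _ _ _).1 (dxP e3) b.
- exact: (wderiv_part _ _ _).1 (dxP e8) b.
- by have [g _ /wderiv_part/(_ b)[]] := dxxP e4.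
- exact: (L2_part _ _).1 e5 b.
- exact: (L2_part _ _).1 e6 b.
- exact: (L2_part _ _).1 e7 b.
- have s1 := real_wderiv_sq_integrable (len_gt0 c) d1.
  have s3 := real_wderiv_sq_integrable (len_gt0 c) d3.
  have := sq_integrableZ (h2 c)^-1
    (sq_integrableD (sq_integrableD (sq_integrableZ (-1) s1) s3)
    (sq_integrableZ (HH c) dw.1)).
  congr sq_integrable; apply/funext => x; rewrite part_phi2; ring.
Qed.

Lemma integrable_density z b : in_energy_space c z ->
  integrable_on l (density z b).
Proof.
move=> /(in_energy_space_data b)[d1 d3 dp dw dwt dww y1 y3 yp ph _].
have ywt := real_wderiv_sq_integrable (len_gt0 c) dwt.
have T f (k : R) : sq_integrable l f -> integrable_on l (fun x => k * f x ^+ 2).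
  by move=> sf; exact: integrable_onZ (sq_integrableP sf).
have := integrable_onD
  (integrable_onD
  (integrable_onD
  (integrable_onD
  (integrable_onD
  (integrable_onD
  (integrable_onD (integrable_onD (integrable_onD (integrable_onD
  (T _ (rho1 c * h1 c) y1) (T _ (rho3 c * h3 c) y3)) (T _ (mu c * h3 c) yp))
  (T _ (mass c) ywt)) (T _ (K1 c) dwt.1)) (T _ (alpha1 c * h1 c) d1.1))
  (T _ (alpha3 c * h3 c) d3.1)) (T _ (K2 c) dww))
  (integrable_onZ (- 2 * (gamma c * beta c * h3 c)) (sq_integrableM d3.1 dp.1)))
  (T _ (beta c * h3 c) dp.1)) (T _ (G2 c * h2 c) ph).
by congr integrable_on; apply/funext => x; rewrite /density /quad; ring.
Qed.

Lemma density_ge z b x :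
  let q := density z b x in
  [/\ rho1 c * h1 c * part b (v1_t z x) ^+ 2 <= q,
      rho3 c * h3 c * part b (v3_t z x) ^+ 2 <= q,
      mu c * h3 c * part b (p_t z x) ^+ 2 <= q &
      K1 c * part b (dx l (w_t z) x) ^+ 2 <= q] /\
  [/\ alpha1 c * h1 c * part b (dx l (v1 z) x) ^+ 2 <= q,
      alpha31 c * h3 c * part b (dx l (v3 z) x) ^+ 2 <= q,
      coupled_stiffness * part b (dx l (p z) x) ^+ 2 <= q &
      G2 c * h2 c * part b (phi2 c (v1 z) (v3 z) (dx l (w z)) x) ^+ 2 <= q].
Proof. exact: quad_ge. Qed.

Lemma density_ge0 z b x : 0 <= density z b x.
Proof.
have [[h _ _ _] _] := density_ge z b x.
by apply: le_trans h; rewrite mulr_ge0 ?sqr_ge0// ltW// mulr_gt0 ?coeff_gt0.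
Qed.

(** An infinite integral would be read as energy 0, so comparing integrands
    requires the integrability of the density. *)
Lemma energy_controls z b (g : R -> R) (a : R) : in_energy_space c z ->
  sq_integrable l g -> 0 < a -> (forall x, a * g x ^+ 2 <= density z b x) ->
  forall x, 0 <= x <= l -> `|itg 0 x g| <= Num.sqrt (l / a) * energy_norm c z.
Proof.
move=> zE sg a0 gb x /andP[x0 xl]; have l0 := len_gt0 c.
have dt := integrable_density true zE; have df := integrable_density false zE.
have h : a * itg 0 l (fun s => g s ^+ 2) <= energy2 c z.
  rewrite energy2_density /itg -RintegralZl//; last exact: sq_integrableP.
  apply: le_Rintegral => //.
  - exact: integrable_onZ (sq_integrableP sg).
  - exact: integrable_onD.
  - move=> s _; apply: le_trans (gb s) _.
    by case: (b); [rewrite lerDl|rewrite lerDr]; exact: density_ge0.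
have h2 := itg_sqr_le (lexx 0) x0 xl sg; rewrite subr0 in h2.
have -> : Num.sqrt (l / a) * energy_norm c z = Num.sqrt (l / a * energy2 c z).
  by rewrite /energy_norm (@sqrtrM _ (l / a))//;
    exact: divr_ge0 (ltW l0) (ltW a0).
rewrite -sqrtr_sqr; apply: ler_wsqrtr.
apply: le_trans h2 _; set J := itg 0 l _ in h *.
have J0 : 0 <= J by apply: Rintegral_ge0 => s _; exact: sqr_ge0.
apply: (@le_trans _ _ (l * J)); first by rewrite ler_wpM2r.
rewrite -mulrA ler_wpM2l ?(ltW l0)// mulrC ler_pdivlMr// mulrC.
exact: h.
Qed.

Definition controlled (Phi : state R -> R -> R) := exists2 K, 0 <= K &
  forall z, in_energy_space c z -> forall x, 0 <= x <= l ->
    `|Phi z x| <= K * energy_norm c z.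

Lemma controlled_itg b (g : state R -> R -> R) (a : R) : 0 < a ->
  (forall z, in_energy_space c z -> sq_integrable l (g z)) ->
  (forall z x, a * g z x ^+ 2 <= density z b x) ->
  controlled (fun z x => itg 0 x (g z)).
Proof.
move=> a0 sg gb; exists (Num.sqrt (l / a)); first exact: sqrtr_ge0.
by move=> z zE x xl; apply: (energy_controls zE (sg z zE) a0 (gb z)).
Qed.

Lemma eq_controlled (F G : state R -> R -> R) :
  (forall z, in_energy_space c z -> forall x, 0 <= x <= l -> F z x = G z x) ->
  controlled F -> controlled G.
Proof.
move=> FG [K K0 FK]; exists K => // z zE x xl; rewrite -FG//; exact: FK.
Qed.

Lemma controlled_velocities b :
  [/\ controlled (fun z x => itg 0 x (fun s => part b (v1_t z s))),
  controlled (fun z x => itg 0 x (fun s => part b (v3_t z s))) &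
  controlled (fun z x => itg 0 x (fun s => part b (p_t z s)))].
Proof.
split.
- apply: (@controlled_itg b _ (rho1 c * h1 c)) =>
  [|z /(in_energy_space_data b)[]//|z x].
    by rewrite mulr_gt0 ?coeff_gt0.
  by case: (density_ge z b x) => -[].
- apply: (@controlled_itg b _ (rho3 c * h3 c)) =>
  [|z /(in_energy_space_data b)[]//|z x].
    by rewrite mulr_gt0 ?coeff_gt0.
  by case: (density_ge z b x) => -[].
- apply: (@controlled_itg b _ (mu c * h3 c)) =>
  [|z /(in_energy_space_data b)[]//|z x].
    by rewrite mulr_gt0 ?coeff_gt0.
  by case: (density_ge z b x) => -[].
Qed.

Lemma from_left_end b (f g : cfun R) x :
  real_wderiv l (fun x => part b (f x)) (fun x => part b (g x)) -> f 0 = 0 ->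
  0 <= x <= l -> itg 0 x (fun s => part b (g s)) = part b (f x).
Proof. by move=> [_ fg] f0 xl; rewrite (fg x xl) f0 part0 add0r. Qed.

Lemma controlled_displacements b : [/\ controlled (fun z x => part b (v1 z x)),
  controlled (fun z x => part b (v3 z x)),
  controlled (fun z x => part b (p z x)) & controlled (fun z x =>
    part b (w_t z x))].
Proof.
split.
- apply: (@eq_controlled (fun z x =>
  itg 0 x (fun s => part b (dx l (v1 z) s)))).
    move=> z /(in_energy_space_data b)[d1 d3 dp dw dwt dww y1 y3 yp ph
      [z1 z3 zp zw zwt]] x xl.
    exact: from_left_end xl.
  apply: (@controlled_itg b _ (alpha1 c * h1 c)) =>
    [|z /(in_energy_space_data b)[[]]//|z x].
    by rewrite mulr_gt0 ?coeff_gt0.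
  by case: (density_ge z b x) => -[] ? ? ? ? [].
- apply: (@eq_controlled (fun z x =>
  itg 0 x (fun s => part b (dx l (v3 z) s)))).
    move=> z /(in_energy_space_data b)[d1 d3 dp dw dwt dww y1 y3 yp ph
      [z1 z3 zp zw zwt]] x xl.
    exact: from_left_end xl.
  apply: (@controlled_itg b _ (alpha31 c * h3 c)) =>
    [|z /(in_energy_space_data b)[_ []]//|z x].
    by rewrite mulr_gt0 ?coeff_gt0.
  by case: (density_ge z b x) => -[] ? ? ? ? [].
- apply: (@eq_controlled (fun z x => itg 0 x (fun s => part b (dx l (p z) s)))).
    move=> z /(in_energy_space_data b)[d1 d3 dp dw dwt dww y1 y3 yp ph
      [z1 z3 zp zw zwt]] x xl.
    exact: from_left_end xl.
  apply: (@controlled_itg b _ coupled_stiffness) =>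
    [|z /(in_energy_space_data b)[_ _ []]//|z x].
    exact: coupled_stiffness_gt0.
  by case: (density_ge z b x) => -[] ? ? ? ? [].
- apply: (@eq_controlled (fun z x =>
  itg 0 x (fun s => part b (dx l (w_t z) s)))).
    move=> z /(in_energy_space_data b)[d1 d3 dp dw dwt dww y1 y3 yp ph
      [z1 z3 zp zw zwt]] x xl.
    exact: from_left_end xl.
  apply: (@controlled_itg b _ (K1 c)) =>
    [|z /(in_energy_space_data b)[_ _ _ _ []]//|z x].
    exact: K1_gt0.
  by case: (density_ge z b x) => -[].
Qed.

(** The shear term of the energy controls h2 phi2 = - v1 + v3 + H w_x, and the
    other terms control v1 and v3; so w_x is controlled as well. *)
Lemma controlled_w b : controlled (fun z x => part b (w z x)).
Proof.
have [[A1 A10 h1] [A3 A30 h3] _ _] := controlled_displacements b.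
have [Ap Ap0 hp] : controlled (fun z x =>
  itg 0 x (fun s => part b (phi2 c (v1 z) (v3 z) (dx l (w z)) s))).
  apply: (@controlled_itg b _ (G2 c * h2 c)) =>
    [|z /(in_energy_space_data b)[]//|z x].
    by rewrite mulr_gt0 ?coeff_gt0.
  by case: (density_ge z b x) => -[] ? ? ? ? [].
have H0 := HH_gt0; have h20 := h2_gt0 c; have l0 := len_gt0 c.
exists ((HH c)^-1 * (h2 c * Ap + l * A1 + l * A3)).
  apply: mulr_ge0; first by rewrite invr_ge0 ltW.
  by apply: addr_ge0; [apply: addr_ge0|]; apply: mulr_ge0 => //; exact: ltW.
move=> z zE x /andP[x0 xl].
have [d1 d3 dp dw dwt dww y1 y3 yp ph [z1 z3 zp zw zwt]] :=
  in_energy_space_data b zE.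
have s1 := real_wderiv_sq_integrable (len_gt0 c) d1.
have s3 := real_wderiv_sq_integrable (len_gt0 c) d3.
have bd (g : R -> R) (B : R) : sq_integrable l g -> (forall s, 0 <= s <= l ->
  `|g s| <= B) ->
    `|itg 0 x g| <= l * B.
  move=> sg gB; have ig := sq_integrable_sub (lexx 0) xl sg.
  have B0 : 0 <= B by apply: le_trans (gB 0 _); rewrite ?normr_ge0// lexx ltW.
  apply: (@le_trans _ _ (B * (x - 0))); last by rewrite subr0 mulrC ler_wpM2r.
  rewrite -(itg_cst B x0) /itg; apply: le_trans (le_normr_Rintegral _ ig) _ =>
    //.
  apply: le_Rintegral => //.
  - by move/integrable_norm: ig; apply: eq_integrable.
  - exact: sq_integrable_sub (sq_integrable_cst l B).
  - move=> s /=; rewrite in_itv/= => /andP[s0 sx]; apply: gB.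
    by rewrite (ltW s0) (le_trans (ltW sx)).
have -> : part b (w z x) = (HH c)^-1 *
    (h2 c * itg 0 x (fun s => part b (phi2 c (v1 z) (v3 z) (dx l (w z)) s)) +
     itg 0 x (fun s => part b (v1 z s)) - itg 0 x (fun s => part b (v3 z s))).
  have -> : part b (w z x) = itg 0 x (fun s => part b (dx l (w z) s)).
    by rewrite (from_left_end dw zw)// x0.
  have -> : (fun s => part b (dx l (w z) s)) =
    (fun s => (HH c)^-1 * (h2 c * part b (phi2 c (v1 z) (v3 z) (dx l (w z)) s) +
    (part b (v1 z s) + (-1) * part b (v3 z s)))).
    by apply/funext => s; rewrite part_phi2; field; rewrite !gt_eqF.
  have sN3 := sq_integrableZ (-1) s3.
  rewrite (itgZ _ (lexx 0) xl); last by do 2 ?apply: sq_integrableD => //;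
    exact: sq_integrableZ.
  rewrite (itgD (lexx 0) xl); [|exact: sq_integrableZ|exact: sq_integrableD].
  rewrite (itgD (lexx 0) xl)// !(itgZ _ (lexx 0) xl)//.
  by ring.
have Hi : 0 <= (HH c)^-1 by rewrite invr_ge0 ltW.
rewrite normrM (ger0_norm Hi) -mulrA; apply: (ler_wpM2l Hi).
rewrite (le_trans (ler_normD _ _))// normrN
  (le_trans (lerD (ler_normD _ _) (lexx _)))//.
rewrite !mulrDl normrM (ger0_norm (ltW h20)) -!mulrA.
apply: lerD; first apply: lerD.
- by apply: ler_wpM2l; [exact: ltW|apply: hp => //; rewrite x0].
- by apply: bd => // s sl; exact: h1.
- by apply: bd => // s sl; exact: h3.
Qed.

(** Applied to the error of the difference quotient of U, a real-linear
    functional bounded by the energy norm inherits the derivative of U,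
    uniformly in x. *)
Lemma controlled_uniform_derive (U u : R -> state R) (Phi : state R -> R -> R) :
  energy_derivative c U u ->
  (forall t, 0 <= t -> in_energy_space c (U t) /\ in_energy_space c (u t)) ->
  controlled Phi ->
  (forall k A B C x, in_energy_space c A -> in_energy_space c B ->
    in_energy_space c C ->
    0 <= x <= l -> Phi (k%:C *: (A - B) - C) x = k * (Phi A x - Phi B x) -
      Phi C x) ->
  uniform_derive `[0, l] (fun t => Phi (U t)) (fun t => Phi (u t)).
Proof.
move=> Uu E [K K0 hK] lin t t0 e e0.
have K1p : 0 < 1 + K by rewrite ltr_pwDl.
have e1 : 0 < e / (1 + K) by rewrite divr_gt0.
have := Uu t t0 => /cvgrPdist_le /(_ _ e1); rewrite near_withinE near_withinE =>
  H.
near=> s => s0 x /=; rewrite in_itv/= => xl.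
have Hs : s != t -> s \in `[0, +oo[ ->
    `|0 - energy_norm c (((s - t)^-1)%:C *: (U s - U t) - u t)| <= e / (1 + K).
  by near: s; exact: H.
have [->|st] := eqVneq s t.
  by rewrite !subrr mulr0 subr0 normr0 mulr0.
have [Us us] := E s s0; have [Ut ut] := E t t0.
set z := ((s - t)^-1)%:C *: (U s - U t) - u t.
have zE : in_energy_space c z by exact: in_energy_space_comb.
have zn : energy_norm c z <= e / (1 + K).
  move: Hs; rewrite in_itv/= s0 => /(_ st isT);
    rewrite sub0r normrN ger0_norm//.
  exact: sqrtr_ge0.
have stn : s - t != 0 by rewrite subr_eq0.
have -> : Phi (U s) x - Phi (U t) x - Phi (u t) x * (s - t) = (s - t) * Phi z x.
  by rewrite lin//; field.
rewrite normrM mulrC ler_wpM2r// (le_trans (hK z zE x xl))//.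
rewrite (le_trans (ler_wpM2l K0 zn))// mulrA ler_pdivrMr// mulrC ler_wpM2l
  ?(ltW e0)//.
by rewrite lerDr.
Unshelve. all: by end_near. Qed.

End Energy.

(** * States at rest and the generator without bending *)

Section Rest.
Variables (R : realType) (c : coeffs R).
Local Notation mu_ := (@lebesgue_measure R).
Local Notation l := (len c).
Implicit Types (z : state R) (b : bool) (x : R).

(** Velocities are only classes of square integrable functions, so they are
    tested by their primitives. *)
Definition at_rest z b := forall x, 0 <= x <= l ->
  [/\ part b (v1 z x) = 0, part b (v3 z x) = 0, part b (p z x) = 0,
      part b (w z x) = 0 & part b (w_t z x) = 0] /\
  [/\ itg 0 x (fun s => part b (v1_t z s)) = 0,
      itg 0 x (fun s => part b (v3_t z s)) = 0 &
      itg 0 x (fun s => part b (p_t z s)) = 0].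

Lemma density_at_rest z b : in_energy_space c z -> at_rest z b ->
  \forall x \ae mu_, x \in `]0, l[ -> density c z b x = 0.
Proof.
move=> zE r; have l0 := len_gt0 c.
have [d1 d3 dp dw dwt dww y1 y3 yp ph _] := in_energy_space_data b zE.
have w0 x : 0 <= x <= l -> part b (w z x) = 0 by move=> /r[[]].
have a1 := itg_eq0_ae l0 y1 (fun x xl => let: conj _ (And3 h _ _) :=
  r x xl in h).
have a2 := itg_eq0_ae l0 y3 (fun x xl => let: conj _ (And3 _ h _) :=
  r x xl in h).
have a3 := itg_eq0_ae l0 yp (fun x xl => let: conj _ (And3 _ _ h) :=
  r x xl in h).
have a4 := itg_eq0_ae l0 dwt.1 (real_wderiv0 l0 dwt (fun x xl =>
  let: conj (And5 _ _ _ _ h) _ := r x xl in h)).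
have a5 := itg_eq0_ae l0 d1.1 (real_wderiv0 l0 d1 (fun x xl =>
  let: conj (And5 h _ _ _ _) _ := r x xl in h)).
have a6 := itg_eq0_ae l0 d3.1 (real_wderiv0 l0 d3 (fun x xl =>
  let: conj (And5 _ h _ _ _) _ := r x xl in h)).
have a7 := itg_eq0_ae l0 dp.1 (real_wderiv0 l0 dp (fun x xl =>
  let: conj (And5 _ _ h _ _) _ := r x xl in h)).
have a8 := itg_eq0_ae l0 dw.1 (real_wderiv0 l0 dw w0).
have a9 : \forall x \ae mu_, x \in `]0, l[ -> part b (dxx l (w z) x) = 0.
  have wH : H2L l (w z) by case: zE => -[].
  have [g wg0 gk0] := dxxP wH.
  have wg := (wderiv_part _ _ _).1 wg0 b; have gk :=
    (wderiv_part _ _ _).1 gk0 b.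
  exact: itg_eq0_ae l0 dww
    (real_wderiv0 l0 gk (real_wderiv_derive0 l0 wg gk w0)).
have H := ae_and a1
  (ae_and a2 (ae_and a3
  (ae_and a4 (ae_and a5 (ae_and a6 (ae_and a7 (ae_and a8 a9))))))).
move: H; apply: ae_mono.
move=> x [e1 [e2 [e3 [e4 [e5 [e6 [e7 [e8 e9]]]]]]]] xl.
have xl' : 0 <= x <= l by move: xl; rewrite in_itv/= => /andP[/ltW -> /ltW ->].
have [[f1 f3 _ _ f5] _] := r x xl'.
rewrite /density part_phi2 e1// e2// e3// e4// e5// e6// e7// e8// e9// f1 f3
  f5.
by rewrite /quad; ring.
Qed.

Lemma energy_at_rest z : in_energy_space c z -> (forall b, at_rest z b) ->
  energy_norm c z = 0.
Proof.
move=> zE r; rewrite /energy_norm energy2_density.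
suff -> : itg 0 l (fun x => density c z true x + density c z false x) =
  0 by rewrite sqrtr0.
rewrite /itg /Rintegral.
rewrite (@ae_eq_integral _ _ _ mu_ _ (cst 0%E)) ?integral0//.
- by case/integrableP: (integrable_onD (integrable_density true zE)
  (integrable_density false zE)).
- have H := ae_and (density_at_rest zE (r true)) (density_at_rest zE (r false)).
  move: H; apply: ae_mono.
  by move=> x [h1 h2] xl; rewrite /= h1// h2// addr0.
Qed.

(** Without bending, the shear force q has derivative m w_tt = 0 and vanishes at
    x = L, so it vanishes identically; the remaining terms of its definition
    give phi2 = 0, that is v1 = v3. The pair consists of the derivatives of v1
    and p. *)
Lemma generator_part k1 k2 k3 k4 (U f : state R) b :
  generator c k1 k2 k3 k4 U f ->
  (forall x, 0 <= x <= l -> [/\ part b (w U x) = 0, part b (w f x) =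
    0 & part b (w_t f x) = 0]) ->
  exists vp : (R -> R) * (R -> R),
  let gb := gamma c * beta c * h3 c in
  [/\ forall x, 0 <= x <= l -> part b (v1 U x) = part b (v3 U x),
      forall x, 0 <= x <= l ->
        has_derive `[0, l] (fun s => part b (v1 U s)) x (vp.1 x) /\
        has_derive `[0, l] (fun s => part b (p U s)) x (vp.2 x),
      forall x, 0 <= x <= l ->
       [/\ rho1 c * h1 c * itg 0 x (fun s => part b (v1_t f s)) =
             alpha1 c * h1 c * (vp.1 x - vp.1 0),
           rho3 c * h3 c * itg 0 x (fun s => part b (v3_t f s)) =
             alpha3 c * h3 c * (vp.1 x - vp.1 0) - gb * (vp.2 x - vp.2 0) &
           mu c * h3 c * itg 0 x (fun s => part b (p_t f s)) =
             beta c * h3 c * (vp.2 x - vp.2 0) - gb * (vp.1 x - vp.1 0)],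
      alpha1 c * h1 c * vp.1 l = - (k1 * part b (v1 f l)) &
      alpha3 c * h3 c * vp.1 l - gb * vp.2 l = 0].
Proof.
move=> [UE fE _
  [v1x [v1xx [v3x
  [v3xx [px [pxx [wx [wxx [wxxx [wtx [wtxx [wttx [q H]]]]]]]]]]]]]] w0.
case: H.
move=> [[/wderiv_part/(_ b) a1 /wderiv_part/(_ b) a1']
  [/wderiv_part/(_ b) a3 /wderiv_part/(_ b) a3']
  [/wderiv_part/(_ b) ap /wderiv_part/(_ b) ap']
  [/wderiv_part/(_ b) aw /wderiv_part/(_ b) aw' /wderiv_part/(_ b) aw'']
  [_ _ /wderiv_part/(_ b) awtt]].
move=> [q1 q3 qp qw /wderiv_part/(_ b) [_ aq]] [b1 b3 _ _ bq].
have l0 := len_gt0 c.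
have ll : 0 <= l <= l by rewrite lexx ltW.
have W0 x : 0 <= x <= l -> part b (w U x) = 0 by move=> /w0[].
have wx0 := real_wderiv_derive0 l0 aw aw' W0.
have wxx0 := real_wderiv_derive0 l0 aw' aw'' wx0.
have iwxxx := real_wderiv0 l0 aw'' wxx0.
have iwttx : forall x, 0 <= x <= l -> itg 0 x (fun s => part b (wttx s)) = 0.
  by apply: real_wderiv0 l0 awtt _ => x /w0[].
have q0 x : 0 <= x <= l -> part b (q x) = 0.
  have qc y : 0 <= y <= l -> part b (q y) = part b (q 0).
    move=> yl; rewrite aq// /itg.
    rewrite (_ : Rintegral _ _ _ = 0) ?addr0//.
    rewrite -[RHS](@itg0 R (fun=> 0)) /itg.
    transitivity (\int[mu_]_(x in `]0, y[) (0 : R)).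
      apply: eq_Rintegral => s; rewrite inE/= in_itv/= => /andP[s0 sy].
      by rewrite partZ; have [|_ _ ->] := w0 s;
        rewrite ?mulr0// (ltW s0)/= (le_trans (ltW sy))//; case/andP: yl.
    by rewrite !Rintegral_cst// !mul0r.
  move=> xl; rewrite qc// -(qc l ll) bq partN partZ.
  by have [_ -> _] := w0 l ll; rewrite mulr0 oppr0.
have s1 := real_wderiv_sq_integrable l0 a1.
have s3 := real_wderiv_sq_integrable l0 a3.
have v13 x : 0 <= x <= l -> part b (v1 U x) = part b (v3 U x).
  move=> xl.
  pose psi s := part b (v3 U s) + (-1) * part b (v1 U s).
  have dpsi := real_wderivD a3 (real_wderivZ (-1) a1).
  have spsi : sq_integrable l psi := real_wderiv_sq_integrable l0 dpsi.
  have ipsi y : 0 <= y <= l -> itg 0 y psi = 0.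
    move=> /andP[y0 yl].
    have e : itg 0 y (fun s => G2 c * HH c * (h2 c)^-1 * psi s) =
       itg 0 y (fun s => - K1 c * part b (wttx s) + K2 c * part b (wxxx s)).
      apply: (ae_eq_itg (lexx 0) yl).
      - exact: sq_integrableZ.
      - by apply: sq_integrableD; apply: sq_integrableZ;
        [exact: awtt.1|exact: aw''.1].
      move: qw; apply: ae_mono => s hs sl.
      have sl' : 0 <= s <= l by move: sl; rewrite in_itv/= =>
        /andP[/ltW -> /ltW ->].
      move: (part_phi2 c (v1 U) (v3 U) wx b s) (hs sl);
        move: (phi2 _ _ _ _ s) => ph.
      rewrite wx0// mulr0 addr0 => phE /(congr1 (part b)).
      by rewrite q0// !partE phE /psi; lra.
    move: e; rewrite (itgZ _ (lexx 0) yl spsi).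
    rewrite (itgD (lexx 0) yl (sq_integrableZ _ awtt.1)
      (sq_integrableZ _ aw''.1)).
    rewrite (itgZ _ (lexx 0) yl awtt.1) (itgZ _ (lexx 0) yl aw''.1).
    rewrite iwxxx ?y0// iwttx ?y0// !mulr0 addr0 => /eqP; rewrite mulf_eq0 =>
      /orP[|/eqP//].
    by rewrite (gt_eqF (divr_gt0 (mulr_gt0 (G2_gt0 c) (HH_gt0 c)) (h2_gt0 c))).
  have psi0 : psi x = 0.
    apply: (has_derive_uniq l0 (@subset_refl _ _) xl (itg_derive spsi xl
      (real_wderiv_cont dpsi xl))).
    apply: eq_has_derive (has_derive_cst `[0, l] 0 x);
      first by rewrite /= in_itv.
    by move=> y; rewrite inE/= in_itv/= => yl; rewrite ipsi.
  by move: psi0; rewrite /psi; lra.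
have d1 x (xl : 0 <= x <= l) := real_wderiv_derive a1 a1' xl.
have d3 x (xl : 0 <= x <= l) := real_wderiv_derive a3 a3' xl.
have dp x (xl : 0 <= x <= l) := real_wderiv_derive ap ap' xl.
have v13x x : 0 <= x <= l -> part b (v3x x) = part b (v1x x).
  move=> xl; apply: (has_derive_uniq l0 (@subset_refl _ _) xl (d3 x xl)).
  apply: eq_has_derive (d1 x xl); first by rewrite /= in_itv.
  by move=> y; rewrite inE/= in_itv/= => yl; rewrite v13.
have ph0 s : 0 <= s <= l -> part b (phi2 c (v1 U) (v3 U) wx s) = 0.
  by move=> sl; rewrite part_phi2 wx0// v13// mulr0; ring.
have [_ _ _ _ _ _ y1 y3 yp _ _] := in_energy_space_data b fE.
have i1 x : 0 <= x <= l -> itg 0 x (fun s => part b (v1xx s)) = part b (v1x x) -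
  part b (v1x 0).
  by move=> xl; rewrite (a1'.2 x xl); ring.
have i3 x : 0 <= x <= l -> itg 0 x (fun s => part b (v3xx s)) = part b (v1x x) -
  part b (v1x 0).
  by move=> xl; rewrite -!v13x//; [rewrite (a3'.2 x xl); ring|rewrite lexx ltW].
have ip x : 0 <= x <= l -> itg 0 x (fun s => part b (pxx s)) = part b (px x) -
  part b (px 0).
  by move=> xl; rewrite (ap'.2 x xl); ring.
exists (fun x => part b (v1x x), fun x => part b (px x)) => /=.
split => //.
- by move=> x xl; split; [exact: d1|exact: dp].
- move=> x xl; have x0 := andP xl; case: x0 => x0 xl'; split.
  + rewrite -i1// -!(itgZ _ (lexx 0) xl')//; last exact: a1'.1.
    apply: (ae_eq_itg (lexx 0) xl');
      [exact: sq_integrableZ|exact: sq_integrableZ a1'.1|].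
    move: q1; apply: ae_mono => s hs sl.
    have sl' : 0 <= s <= l by move: sl; rewrite in_itv/= =>
      /andP[/ltW -> /ltW ->].
    move: (ph0 s sl') (hs sl); move: (phi2 _ _ _ _ s) =>
      ph phE /(congr1 (part b)).
    by rewrite !partE phE; lra.
  + transitivity (itg 0 x (fun s => alpha3 c * h3 c * part b (v3xx s) +
        - (gamma c * beta c * h3 c) * part b (pxx s))).
      rewrite -(itgZ _ (lexx 0) xl')//.
      apply: (ae_eq_itg (lexx 0) xl'); first exact: sq_integrableZ.
        by apply: sq_integrableD; apply: sq_integrableZ;
          [exact: a3'.1|exact: ap'.1].
      move: q3; apply: ae_mono => s hs sl.
      have sl' : 0 <= s <= l by move: sl; rewrite in_itv/= =>
        /andP[/ltW -> /ltW ->].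
      move: (ph0 s sl') (hs sl); move: (phi2 _ _ _ _ s) =>
        ph phE /(congr1 (part b)).
      by rewrite !partE phE; lra.
    rewrite (itgD (lexx 0) xl' (sq_integrableZ _ a3'.1)
      (sq_integrableZ _ ap'.1)).
    by rewrite (itgZ _ (lexx 0) xl' a3'.1)
      (itgZ _ (lexx 0) xl' ap'.1) i3// ip//; ring.
  + transitivity (itg 0 x (fun s => beta c * h3 c * part b (pxx s) +
        - (gamma c * beta c * h3 c) * part b (v3xx s))).
      rewrite -(itgZ _ (lexx 0) xl')//.
      apply: (ae_eq_itg (lexx 0) xl'); first exact: sq_integrableZ.
        by apply: sq_integrableD; apply: sq_integrableZ;
          [exact: ap'.1|exact: a3'.1].
      move: qp; apply: ae_mono => s hs sl.
      by move: (hs sl) => /(congr1 (part b)); rewrite !partE; lra.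
    rewrite (itgD (lexx 0) xl' (sq_integrableZ _ ap'.1)
      (sq_integrableZ _ a3'.1)).
    by rewrite (itgZ _ (lexx 0) xl' a3'.1)
      (itgZ _ (lexx 0) xl' ap'.1) i3// ip//; ring.
- by have := congr1 (part b) b1; rewrite !partE.
- by have := congr1 (part b) b3; rewrite !partE v13x.
Qed.
End Rest.

(** * Mild solutions without bending *)

Section MildSolutions.
Variables (R : realType) (c : coeffs R).
Local Notation l := (len c).

(** The time integral U of the solution is in the domain of the generator, and
    its components satisfy the integrated system of [sandwich_at_rest], so they
    vanish; the solution is their time derivative. That U has no bending follows
    from w(u) = 0 by integration in time, and w_t(u) = 0 from
    w_t(U) = w(u) - w(u(0)) = 0 by differentiation. *)
Lemma sliding_at_rest (k1 k2 k3 k4 : R) (u : R -> state R) b : 0 < k1 ->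
  mild_solution c k1 k2 k3 k4 u -> inertial_sliding c u ->
  forall t, 0 <= t -> at_rest c (u t) b.
Proof.
move=> k10 [uE _ [U [U0 Uu gen]]] hw.
have l0 := len_gt0 c.
have UE t : 0 <= t -> in_energy_space c (U t) by move=> /gen[].
have E t : 0 <= t -> in_energy_space c (U t) /\ in_energy_space c (u t).
  by move=> t0; split; [exact: UE|exact: uE].
have dU := controlled_uniform_derive Uu E.
have disp (F : state R -> cfun R) : controlled c (fun z x => part b (F z x)) ->
    (forall (k : R) (A B C : state R), F (k%:C *: (A - B) - C) =
      comb k (F A) (F B) (F C)) ->
    uniform_derive `[0, l] (fun t x => part b (F (U t) x)) (fun t x =>
      part b (F (u t) x)).
  move=> cF linF; apply: (dU (fun z x => part b (F z x)) cF) =>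
    k A B C x _ _ _ _.
  by rewrite linF /comb !partE.
have velo (F : state R -> cfun R) : controlled c (fun z x =>
  itg 0 x (fun s => part b (F z s))) ->
    (forall z, in_energy_space c z -> sq_integrable l (fun s =>
      part b (F z s))) ->
    (forall (k : R) (A B C : state R), F (k%:C *: (A - B) - C) =
      comb k (F A) (F B) (F C)) ->
    uniform_derive `[0, l] (fun t x => itg 0 x (fun s => part b (F (U t) s)))
      (fun t x => itg 0 x (fun s => part b (F (u t) s))).
  move=> cF sF linF;
    apply: (dU (fun z x => itg 0 x (fun s => part b (F z s))) cF).
  move=> k A B C x /sF sA /sF sB /sF sC /andP[_ xl].
  rewrite linF; have -> : (fun s => part b (comb k (F A) (F B) (F C) s)) =
      (fun s => k * (part b (F A s) + (-1) * part b (F B s)) + (-1) * part b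
        (F C s)).
    by apply/funext => s; rewrite /comb !partE; ring.
  have sB' := sq_integrableZ (-1) sB; have sC' := sq_integrableZ (-1) sC.
  have sAB := sq_integrableD sA sB'.
  rewrite (itgD (lexx 0) xl (sq_integrableZ k sAB) sC')
    (itgZ _ (lexx 0) xl sAB).
  by rewrite (itgD (lexx 0) xl sA sB') !(itgZ _ (lexx 0) xl)//; ring.
have [cv1 cv3 cp cwt] := controlled_displacements c b.
have [cv1t cv3t cpt] := controlled_velocities c b.
have Dv1 := disp (@v1 R) cv1 (fun _ _ _ _ => erefl).
have Dv3 := disp (@v3 R) cv3 (fun _ _ _ _ => erefl).
have Dp := disp (@p R) cp (fun _ _ _ _ => erefl).
have Dwt := disp (@w_t R) cwt (fun _ _ _ _ => erefl).
have Dw := disp (@w R) (controlled_w c b) (fun _ _ _ _ => erefl).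
have Dv1t := velo (@v1_t R) cv1t (fun z zE =>
  data_v1t (in_energy_space_data b zE)) (fun _ _ _ _ => erefl).
have Dv3t := velo (@v3_t R) cv3t (fun z zE =>
  data_v3t (in_energy_space_data b zE)) (fun _ _ _ _ => erefl).
have Dpt := velo (@p_t R) cpt (fun z zE => data_pt (in_energy_space_data b zE))
  (fun _ _ _ _ => erefl).
have wu t x : 0 <= t -> 0 <= x <= l -> w (u t) x = 0.
  by move=> t0 xl; apply: hw; rewrite ?in_itv.
have wU t x : 0 <= t -> 0 <= x <= l -> part b (w (U t) x) = 0.
  move=> t0 xl.
  rewrite (@time_integrate R (fun t => part b (w (U t) x)) (fun t =>
    part b (w (u t) x)) (fun=> 0) (fun s => uniform_derive_at (t :=
    s) Dw xl) _ t t0).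
    by rewrite U0 /= part0 subrr addr0.
  by move=> s s0; rewrite wu// part0; exact: has_derive_cst.
have wtU t x : 0 <= t -> 0 <= x <= l -> part b (w_t (U t) x) = 0.
  move=> t0 xl; have [_ _ [_ _ _ h] _] := gen t t0.
  rewrite -h ?in_itv//; have -> : w (u t - u 0) x = w (u t) x - w (u 0) x by [].
  by rewrite !wu// subrr part0.
have wtu t x : 0 <= t -> 0 <= x <= l -> part b (w_t (u t) x) = 0.
  move=> t0 xl; apply: (has_derive_uniq0 t0 (uniform_derive_at Dwt xl t0)).
  by apply: eq_time_derive (has_derive_cst _ 0 t) => // s s0; rewrite wtU.
have /choice[vp spec] : forall t, exists vp : (R -> R) * (R -> R), 0 <= t ->
  let gb := gamma c * beta c * h3 c in
  [/\ forall x, 0 <= x <= l -> part b (v1 (U t) x) = part b (v3 (U t) x),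
      forall x, 0 <= x <= l ->
        has_derive `[0, l] (fun s => part b (v1 (U t) s)) x (vp.1 x) /\
        has_derive `[0, l] (fun s => part b (p (U t) s)) x (vp.2 x),
      forall x, 0 <= x <= l ->
       [/\ rho1 c * h1 c * itg 0 x (fun s => part b (v1_t (u t - u 0) s)) =
             alpha1 c * h1 c * (vp.1 x - vp.1 0),
           rho3 c * h3 c * itg 0 x (fun s => part b (v3_t (u t - u 0) s)) =
             alpha3 c * h3 c * (vp.1 x - vp.1 0) - gb * (vp.2 x - vp.2 0) &
           mu c * h3 c * itg 0 x (fun s => part b (p_t (u t - u 0) s)) =
             beta c * h3 c * (vp.2 x - vp.2 0) - gb * (vp.1 x - vp.1 0)],
      alpha1 c * h1 c * vp.1 l = - (k1 * part b (v1 (u t - u 0) l)) &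
      alpha3 c * h3 c * vp.1 l - gb * vp.2 l = 0].
  move=> t; have [t0|t0] := leP 0 t; last first.
    by exists (fun=> 0, fun=> 0) => t1; move: t0; rewrite ltNge t1.
  have wf x : 0 <= x <= l -> [/\ part b (w (U t) x) = 0,
      part b (w (u t - u 0) x) = 0 & part b (w_t (u t - u 0) x) = 0].
    move=> xl; split; first exact: wU.
    - have -> : w (u t - u 0) x = w (u t) x - w (u 0) x by [].
      by rewrite !wu// subrr part0.
    - have -> : w_t (u t - u 0) x = w_t (u t) x - w_t (u 0) x by [].
      by rewrite partB !wtu// subrr.
  by have [vp hvp] := generator_part (gen t t0) wf; exists vp.
have v13U t x : 0 <= t -> 0 <= x <= l -> part b (v1 (U t) x) =
  part b (v3 (U t) x).
  by move=> t0; have [h _ _ _ _] := spec t t0; exact: h.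
have v13u t x : 0 <= t -> 0 <= x <= l -> part b (v1 (u t) x) =
  part b (v3 (u t) x).
  move=> t0 xl; apply: (has_derive_uniq0 t0 (uniform_derive_at Dv1 xl t0)).
  apply: eq_time_derive (uniform_derive_at Dv3 xl t0) => // s s0.
  by rewrite v13U.
(* the velocity of U is the displacement of u - u(0) *)
have velE (F G : state R -> cfun R) t x : 0 <= t -> 0 <= x <= l ->
    sq_integrable l (fun s => part b (F (U t) s)) ->
    sq_integrable l (fun s => part b (G (u t) s)) ->
    sq_integrable l (fun s => part b (G (u 0) s)) ->
    ae_on l (fun s => G (u t) s - G (u 0) s = F (U t) s) ->
    itg 0 x (fun s => part b (F (U t) s)) = itg 0 x (fun s =>
      part b (G (u t) s) + (-1) * part b (G (u 0) s)).
  move=> t0 /andP[x0 xl] sF sG sG0 ae; apply: (ae_eq_itg (lexx 0) xl) => //.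
    by apply: sq_integrableD => //; exact: sq_integrableZ.
  by move: ae; apply: ae_mono => s h /h <-; rewrite partB mulN1r.
have sv1 t (t0 : 0 <= t) :=
  real_wderiv_sq_integrable l0 (data_v1 (in_energy_space_data b (uE t t0))).
have sv3 t (t0 : 0 <= t) :=
  real_wderiv_sq_integrable l0 (data_v3 (in_energy_space_data b (uE t t0))).
have sp t (t0 : 0 <= t) :=
  real_wderiv_sq_integrable l0 (data_p (in_energy_space_data b (uE t t0))).
have M1E t x : 0 <= t -> 0 <= x <= l ->
  itg 0 x (fun s => part b (v1_t (U t) s)) =
   itg 0 x (fun s => part b (v1 (u t) s) + (-1) * part b (v1 (u 0) s)).
  move=> t0 xl; apply: velE => //;
    [exact: data_v1t (in_energy_space_data b (UE t t0))|exact: sv1|exact: sv1|].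
  by have [_ _ [h _ _ _] _] := gen t t0.
have M3E t x : 0 <= t -> 0 <= x <= l ->
  itg 0 x (fun s => part b (v3_t (U t) s)) =
   itg 0 x (fun s => part b (v3 (u t) s) + (-1) * part b (v3 (u 0) s)).
  move=> t0 xl; apply: velE => //;
    [exact: data_v3t (in_energy_space_data b (UE t t0))|exact: sv3|exact: sv3|].
  by have [_ _ [_ h _ _] _] := gen t t0.
have MpE t x : 0 <= t -> 0 <= x <= l ->
  itg 0 x (fun s => part b (p_t (U t) s)) =
   itg 0 x (fun s => part b (p (u t) s) + (-1) * part b (p (u 0) s)).
  move=> t0 xl; apply: velE => //;
    [exact: data_pt (in_energy_space_data b (UE t t0))|exact: sp|exact: sp|].
  by have [_ _ [_ _ h _] _] := gen t t0.
have n13 t x : 0 <= t -> 0 <= x <= l ->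
  itg 0 x (fun s => part b (v1_t (u t) s)) =
    itg 0 x (fun s => part b (v3_t (u t) s)).
  move=> t0 xl; apply: (has_derive_uniq0 t0 (uniform_derive_at Dv1t xl t0)).
  apply: eq_time_derive (uniform_derive_at Dv3t xl t0) => // s s0.
  rewrite M1E// M3E//; apply: eq_Rintegral => y; rewrite inE/= in_itv/= =>
    /andP[y0 yx].
  have yl : 0 <= y <= l by rewrite (ltW y0) (le_trans (ltW yx))//;
    case/andP: xl.
  by rewrite !v13u.
have itgBu (F : state R -> cfun R) t x : (F (u t - u 0) = fun s =>
  F (u t) s - F (u 0) s) ->
    (forall t, 0 <= t -> sq_integrable l (fun s => part b (F (u t) s))) ->
      0 <= t -> 0 <= x <= l ->
    itg 0 x (fun s => part b (F (u t - u 0) s)) =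
    itg 0 x (fun s => part b (F (u t) s)) - itg 0 x (fun s =>
      part b (F (u 0) s)).
  move=> FE sF t0 /andP[x0 xl]; rewrite FE.
  have -> : (fun s => part b (F (u t) s - F (u 0) s)) =
    (fun s => part b (F (u t) s) + (-1) * part b (F (u 0) s)).
    by apply/funext => s; rewrite partB mulN1r.
  rewrite (itgD (lexx 0) xl (sF t t0) (sq_integrableZ _ (sF 0 (lexx 0))))
    (itgZ _ (lexx 0) xl (sF 0 (lexx 0))).
  by rewrite mulN1r.
have sv1t t (t0 : 0 <= t) := data_v1t (in_energy_space_data b (uE t t0)).
have sv3t t (t0 : 0 <= t) := data_v3t (in_energy_space_data b (uE t t0)).
have spt t (t0 : 0 <= t) := data_pt (in_energy_space_data b (uE t t0)).
(* the primitive of the velocity of U has derivative v - v(0) *)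
have momx (F : state R -> cfun R) (sF : forall t, 0 <= t ->
  sq_integrable l (fun s => part b (F (u t) s)))
    (cF : forall t x, 0 <= t -> 0 <= x <= l -> cont_in `[0, l] (fun s =>
      part b (F (u t) s)) x) t x :
    0 <= t -> 0 <= x <= l ->
    has_derive `[0, l] (fun x =>
      itg 0 x (fun s => part b (F (u t) s) + (-1) * part b (F (u 0) s))) x
      (part b (F (u t) x) - part b (F (u 0) x)).
  move=> t0 xl; have sF0 := sF 0 (lexx 0); have sFt := sF t t0.
  have := has_deriveD (itg_derive sFt xl (cF t x t0 xl))
    (has_deriveZ (-1) (itg_derive sF0 xl (cF 0 x (lexx 0) xl))).
  rewrite mulN1r; apply: eq_has_derive; first by rewrite /= in_itv.
  move=> y; rewrite inE/= in_itv/= => /andP[y0 yl].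
  by rewrite (itgD (lexx 0) yl sFt (sq_integrableZ _ sF0))
    (itgZ _ (lexx 0) yl sF0).
have cv1x t x : 0 <= t -> 0 <= x <= l -> cont_in `[0, l] (fun s =>
  part b (v1 (u t) s)) x.
  by move=> t0;
    apply: real_wderiv_cont (data_v1 (in_energy_space_data b (uE t t0))).
have cpx t x : 0 <= t -> 0 <= x <= l -> cont_in `[0, l] (fun s =>
  part b (p (u t) s)) x.
  by move=> t0;
    apply: real_wderiv_cont (data_p (in_energy_space_data b (uE t t0))).
have kV : kinematics l (fun t x => part b (v1 (U t) x)) (fun t x =>
  part b (v1 (u t) x))
    (fun t x => (vp t).1 x) (fun t x =>
      itg 0 x (fun s => part b (v1_t (U t) s)))
    (fun t x => itg 0 x (fun s => part b (v1_t (u t) s))).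
  split => //.
  - by move=> x _; rewrite U0 part0.
  - by move=> t x t0 xl; have [_ h _ _ _] := spec t t0; exact: (h x xl).1.
  - by move=> t t0; have [-> _ _ _ _] :=
    data_0 (in_energy_space_data b (UE t t0)); rewrite part0.
  - move=> t x t0 xl; apply: eq_has_derive (momx (@v1 R) sv1 cv1x t x t0 xl);
    first by rewrite /= in_itv.
    by move=> y; rewrite inE/= in_itv/= => yl; rewrite M1E.
  - by move=> t _; rewrite itg0.
have kP : kinematics l (fun t x => part b (p (U t) x)) (fun t x =>
  part b (p (u t) x))
    (fun t x => (vp t).2 x) (fun t x => itg 0 x (fun s => part b (p_t (U t) s)))
    (fun t x => itg 0 x (fun s => part b (p_t (u t) s))).
  split => //.
  - by move=> x _; rewrite U0 part0.
  - by move=> t x t0 xl; have [_ h _ _ _] := spec t t0; exact: (h x xl).2.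
  - by move=> t t0; have [_ _ -> _ _] :=
    data_0 (in_energy_space_data b (UE t t0)); rewrite part0.
  - move=> t x t0 xl; apply: eq_has_derive (momx (@p R) sp cpx t x t0 xl);
    first by rewrite /= in_itv.
    by move=> y; rewrite inE/= in_itv/= => yl; rewrite MpE.
  - by move=> t _; rewrite itg0.
pose n0 x := itg 0 x (fun s => part b (v1_t (u 0) s)).
have wn0 : real_wderiv l n0 (fun s => part b (v1_t (u 0) s)).
  by split; [exact: sv1t|move=> x _; rewrite /n0 itg0 add0r].
have VP : forall t x, 0 <= t -> 0 <= x <= l -> part b (v1 (U t) x) =
  0 /\ part b (p (U t) x) = 0.
  apply: (@sandwich_at_rest R c k1 _ _ _ _ _ _ _ _ _ _ (fun x =>
    itg 0 x (fun s => part b (v1 (u 0) s))) (fun x => itg 0 x n0) k10 kV kP) =>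
    //.
  - by move=> t x t0 xl; exact: itg_cont (sv1t t t0) xl.
  - by move=> x xl; exact: itg_derive (sv1 0 (lexx 0)) xl
    (cv1x 0 x (lexx 0) xl).
  - by move=> x xl; exact: (itg_derive (real_wderiv_sq_integrable l0 wn0) xl
    (real_wderiv_cont wn0 xl)).
  - move=> t x t0 xl; have [_ _ h _ _] := spec t t0; have [e1 e3 ep] := h x xl.
    split.
    + by rewrite -e1 (itgBu (@v1_t R)).
    + by rewrite -e3 (itgBu (@v3_t R))// !n13.
    + by rewrite -ep (itgBu (@p_t R)).
  - by move=> t t0; have [_ _ _ h _] := spec t t0; rewrite h -partB.
  - by move=> t t0; have [_ _ _ _ h] := spec t t0.
move=> t t0 x xl.
have [v0 nv0 _] := kinematics_at_rest l0 kV (fun t x t0 xl =>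
  (VP t x t0 xl).1) t0 xl.
have [p0 np0 _] := kinematics_at_rest l0 kP (fun t x t0 xl =>
  (VP t x t0 xl).2) t0 xl.
split; split => //.
- by rewrite -v13u.
- by rewrite wu// part0.
- exact: wtu.
- by rewrite -n13.
Qed.

End MildSolutions.

Theorem theorem5p1 (R : realType) (c : coeffs R) (k1 k2 k3 k4 : R)
    (hk1 : 0 < k1) (hk2 : 0 < k2) (hk3 : 0 < k3) (hk4 : 0 < k4)
    (phi : R -> state R)
    (hphi : mild_solution c k1 k2 k3 k4 phi)
    (hw : inertial_sliding c phi) :
  energy_norm c (phi t) @[t --> +oo%R] --> (0 : R).
Proof.
apply: cvg_near_cst; near=> t.
have t0 : 0 <= t by near: t; exact: nbhs_pinfty_ge.
apply/energy_at_rest; first by case: hphi => h _ _; exact: h.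
by move=> b; exact: (@sliding_at_rest R c k1 k2 k3 k4 phi b hk1 hphi hw t t0).
Unshelve. all: by end_near. Qed.
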